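(* Let $k$ be a field with $\operatorname{char}(k)\neq2,3$. For any $a,b\in k^*$, let $\mathcal C$ be the projective curve $Z^3=aX^3+bY^3$ over $k$. Then $\mathcal C$ is a principal homogeneous space for the elliptic curve $\mathcal E:Y^2=X^3+c$, where $c=-\frac{27}{4}a^2b^2$, and $\mathcal C$ lies in the image of $\Psi:H^1(k,\mathcal T)\to H^1(k,\mathcal E)$, where $\mathcal T=\{\mathcal O,(0,\sqrt c),(0,-\sqrt c)\}$ and $\Psi$ is induced by the inclusion $\mathcal T\hookrightarrow\mathcal E(k_s)$. Specifically, $\mathcal C$ is the curve corresponding to $\Psi[\gamma_t]$ for $t=-b/a$, and also for $t=a$ and for $t=b$.
   Context: $k_s$ is a separable closure of $k$, $G_k=\operatorname{Gal}(k_s/k)$. $\mathcal E$ is the projective elliptic curve with point at infinity $\mathcal O$ as identity; $(0,\sqrt c)$ has order 3. $H^1(k,\mathcal E)=H^1(G_k,\mathcal E(k_s))$ classifies principal homogeneous spaces of $\mathcal E$ over $k$; the curve corresponding to a class is the underlying smooth projective curve, determined up to $k$-isomorphism. Let $\Delta=-c/27=(ab/2)^2$. Fix a primitive cube root of unity $\omega\in k_s$ and fix $\sqrt c\in k_s$ and $\sqrt\Delta\in k$ with $\sqrt c=3(2\omega+1)\sqrt\Delta$. Put $P=(0,\sqrt c)$; then $P\mapsto\omega$ gives an isomorphism of $G_k$-modules $\mathcal T\cong\mu_3$. For $t\in k^*$ choose $\epsilon\in k_s$ with $\epsilon^3=t$; $\gamma_t:G_k\to\mathcal T$ is the 1-cocycle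 with $\gamma_t(\rho)=\mathcal O,\ P,\ -P$ according as $\rho(\epsilon)=\epsilon,\ \omega\epsilon,\ \omega^2\epsilon$, and $[\gamma_t]\in H^1(k,\mathcal T)$ is its class (trivial if $t\in k^{*3}$). *)

(* Defs.v *)
From HB Require Import structures.
From mathcomp Require Import all_boot all_order all_algebra all_field.
From mathcomp Require Import mpoly ring.
From Stdlib Require Import IndefiniteDescription.

Set Implicit Arguments.
Unset Strict Implicit.
Unset Printing Implicit Defensive.

Import GRing.Theory.
Local Open Scope ring_scope.

(* ------------------------------------------------------------------------ *)
(*  Separable closures and their Galois groups                              *)
(* ------------------------------------------------------------------------ *)

Record separable_closure (k ks : fieldType) (iota : {rmorphism k -> ks}) : Prop
  := SeparableClosure {
  sepcl_algebraic : forall x : ks,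
    exists2 p : {poly k}, separable_poly p & root (map_poly iota p) x;
  sepcl_closed : forall p : {poly ks},
    separable_poly p -> (1 < size p)%N -> exists x, root p x }.

Section Galois.
Variables (k ks : fieldType) (iota : {rmorphism k -> ks}).

Record Gal := MkGal {
  gal_mor :> {rmorphism ks -> ks};
  gal_bij : bijective gal_mor;
  gal_fix : forall x, gal_mor (iota x) = iota x }.

Definition gal_mul (s t : Gal) : Gal :=
  @MkGal (gal_mor s \o gal_mor t) (bij_comp (gal_bij s) (gal_bij t))
    (fun x => etrans (congr1 s (gal_fix t x)) (gal_fix s x)).

(* Continuity for the Krull topology on the source and the discrete topology
   on the target: a basic neighbourhood of s consists of the automorphisms
   that agree with s on a given finite subset of ks. *)
Definition gal_continuous (M : Type) (f : Gal -> M) :=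
  forall s : Gal, exists S : seq ks,
    forall t : Gal, {in S, t =1 s} -> f t = f s.

End Galois.

(* ------------------------------------------------------------------------ *)
(*  The projective plane and plane projective curves                        *)
(* ------------------------------------------------------------------------ *)

Section P2.
Variable L : fieldType.

(* A point of the projective plane is represented by its unique homogeneous
   coordinate vector (x, y, z) whose last nonzero entry is 1. *)
Definition pivot (v : 'rV[L]_3) : L :=
  if v 0 2 != 0 then v 0 2 else if v 0 1 != 0 then v 0 1 else v 0 0.

Definition P2 := {v : 'rV[L]_3 | pivot v == 1}.

Definition vec3 (x y z : L) : 'rV[L]_3 := \row_(i < 3) [:: x; y; z]`_i.

Lemma vec3E x y z :
  (vec3 x y z 0 0 = x) * (vec3 x y z 0 1 = y) * (vec3 x y z 0 2 = z).
Proof. by rewrite !mxE. Qed.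

Lemma vec3_eta (v : 'rV[L]_3) : v = vec3 (v 0 0) (v 0 1) (v 0 2).
Proof.
apply/rowP => i; rewrite mxE.
by case: i => [[|[|[|//]]] Hi] /=; congr (v _ _); apply: val_inj.
Qed.

Lemma pivot_pt0 : pivot (vec3 0 1 0) == 1.
Proof. by rewrite /pivot !vec3E eqxx oner_neq0. Qed.

Definition pt0 : P2 := exist (fun v => pivot v == 1) _ pivot_pt0.

(* The point with homogeneous coordinates v; only meaningful for v != 0, the
   value at v = 0 being the junk value (0 : 1 : 0). *)
Definition proj (v : 'rV[L]_3) : P2 := insubd pt0 ((pivot v)^-1 *: v).

Definition pX (P : P2) : L := val P 0 0.
Definition pY (P : P2) : L := val P 0 1.
Definition pZ (P : P2) : L := val P 0 2.

Definition affpt (x y : L) : P2 := proj (vec3 x y 1).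

Lemma affptE x y :
  (pX (affpt x y) = x) * (pY (affpt x y) = y) * (pZ (affpt x y) = 1).
Proof.
have p1 : pivot (vec3 x y 1) = 1 by rewrite /pivot !vec3E oner_neq0.
by rewrite /pX /pY /pZ /affpt /proj p1 invr1 scale1r val_insubd p1 eqxx !vec3E.
Qed.

Lemma P2_inj (P Q : P2) : pX P = pX Q -> pY P = pY Q -> pZ P = pZ Q -> P = Q.
Proof.
by move=> hx hy hz; apply: val_inj; rewrite [LHS]vec3_eta [RHS]vec3_eta;
  congr vec3.
Qed.

Lemma affpt_neq0 x y : affpt x y != pt0.
Proof.
apply/eqP => /(congr1 pZ); rewrite affptE /pZ /= vec3E => /eqP.
by rewrite oner_eq0.
Qed.

End P2.

Section PlaneCurves.
Variable k : fieldType.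
Implicit Types (F G H : {mpoly k[3]}) (L : fieldType).

Definition on_curve L (j : {rmorphism k -> L}) F (P : P2 L) : bool :=
  mmap j (fun i => val P 0 i) F == 0.

(* The plane projective curve F = 0 is smooth over k: no singular point with
   coordinates in any extension field of k. (Such a curve is automatically
   geometrically irreducible.) *)
Definition smooth_plane_curve F : Prop :=
  (exists2 d, (0 < d)%N & F \is d.-homog) /\
  forall L (j : {rmorphism k -> L}) (P : P2 L), on_curve j F P ->
    exists i, mmap j (fun i => val P 0 i) F^`M(i) != 0.

(* p is homogeneous of degree d in the first three variables and homogeneous
   of degree e in the last three. *)
Definition bihomog d e (p : {mpoly k[3 + 3]}) : bool :=
  all (fun m : 'X_{1..3 + 3} =>
    (\sum_(i < 3) m (lshift 3 i) == d)%N &&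
    (\sum_(i < 3) m (rshift 3 i) == e)%N) (msupp p).

Definition bieval L (j : {rmorphism k -> L}) (phi : 'rV[{mpoly k[3 + 3]}]_3)
    (P Q : P2 L) : 'rV[L]_3 :=
  \row_i mmap j (fun l => row_mx (val P) (val Q) 0 l) (phi 0 i).

(* A morphism F x G -> H between plane curves is given by a finite list of
   triples of bihomogeneous polynomials over k, such that at every point of
   F x G (over any extension field of k) some triple of the list does not
   vanish and all those that do not vanish define the same point of H. *)
Definition bimap := seq 'rV[{mpoly k[3 + 3]}]_3.

Definition biapp L (j : {rmorphism k -> L}) (mu : bimap) (P Q : P2 L) : P2 L :=
  proj (head 0 [seq v <- [seq bieval j phi P Q | phi <- mu] | v != 0]).

Definition is_bimorphism F G H (mu : bimap) : Prop :=
  (forall phi, phi \in mu -> exists d e, forall i, bihomog d e (phi 0 i)) /\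
  forall L (j : {rmorphism k -> L}) (P Q : P2 L),
    on_curve j F P -> on_curve j G Q ->
    [/\ exists2 phi, phi \in mu & bieval j phi P Q != 0,
        forall phi, phi \in mu -> bieval j phi P Q != 0 ->
          proj (bieval j phi P Q) = biapp j mu P Q
      & on_curve j H (biapp j mu P Q)].

End PlaneCurves.

(* ------------------------------------------------------------------------ *)
(*  The curve Y^2 = X^3 + c                                                 *)
(* ------------------------------------------------------------------------ *)

Definition weierstrass (k : fieldType) (c : k) : {mpoly k[3]} :=
  'X_1 ^+ 2 * 'X_2 - 'X_0 ^+ 3 - c *: 'X_2 ^+ 3.

Section EllipticCurve.
Variables (k : fieldType) (c : k) (L : fieldType) (j : {rmorphism k -> L}).

Definition EC := {P : P2 L | on_curve j (weierstrass c) P}.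

Lemma on_weierstrassE P : on_curve j (weierstrass c) P =
  (pY P ^+ 2 * pZ P == pX P ^+ 3 + j c * pZ P ^+ 3).
Proof.
rewrite /on_curve /weierstrass !rmorphB /= rmorphM /= !rmorphXn /=.
rewrite mmapZ rmorphXn /= !mmapX !mmap1U -!/(pX P) -!/(pY P) -!/(pZ P).
by rewrite -addrA -opprD subr_eq0.
Qed.

Lemma on_weierstrass_aff x y :
  on_curve j (weierstrass c) (affpt x y) = (y ^+ 2 == x ^+ 3 + j c).
Proof. by rewrite on_weierstrassE !affptE expr1n !mulr1. Qed.

Lemma on_weierstrass0 : on_curve j (weierstrass c) (pt0 L).
Proof.
by rewrite on_weierstrassE /pX /pY /pZ /= !vec3E mulr0 !expr0n mulr0 addr0.
Qed.

(* The points of E other than O are affine. *)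
Lemma on_weierstrassP P : on_curve j (weierstrass c) P -> P != pt0 L ->
  exists x y, P = affpt x y /\ y ^+ 2 = x ^+ 3 + j c.
Proof.
rewrite on_weierstrassE => hP nP.
have [z0|z0] := eqVneq (pZ P) 0.
  case/negP: nP; move: hP (valP P).
  rewrite z0 mulr0 expr0n mulr0 addr0 eq_sym expf_eq0 /= => /eqP x0.
  rewrite /pivot -/(pZ P) -/(pY P) -/(pX P) z0 x0 eqxx /=.
  case: ifP => [_ /eqP y1|_]; last by rewrite eq_sym oner_eq0.
  by apply/eqP/P2_inj; rewrite ?z0 ?x0 ?y1 /pX /pY /pZ /= !vec3E.
have z1 : pZ P = 1 by move: (valP P); rewrite /pivot -/(pZ P) z0 => /eqP.
exists (pX P), (pY P); split; first by apply: P2_inj; rewrite !affptE.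
by move/eqP: hP; rewrite z1 expr1n !mulr1.
Qed.

Definition ec0 : EC := exist (on_curve j (weierstrass c)) _ on_weierstrass0.

Definition neg_pt (P : P2 L) : P2 L :=
  if P == pt0 L then pt0 L else affpt (pX P) (- pY P).

(* The chord-and-tangent law. *)
Definition add_pt (P Q : P2 L) : P2 L :=
  let: (x1, y1, x2, y2) := (pX P, pY P, pX Q, pY Q) in
  let chord l := let x3 := l ^+ 2 - x1 - x2 in affpt x3 (l * (x1 - x3) - y1) in
  if P == pt0 L then Q else
  if Q == pt0 L then P else
  if x1 != x2 then chord ((y2 - y1) / (x2 - x1)) else
  if y1 == - y2 then pt0 L else chord (3 * x1 ^+ 2 / (2 * y1)).

Lemma neg_pt_on P :
  on_curve j (weierstrass c) P -> on_curve j (weierstrass c) (neg_pt P).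
Proof.
move=> hP; rewrite /neg_pt; case: ifPn => [_|nP]; first exact: on_weierstrass0.
have [x [y [-> e]]] := on_weierstrassP hP nP.
by rewrite on_weierstrass_aff !affptE sqrrN e.
Qed.

Lemma add_pt_on P Q : on_curve j (weierstrass c) P ->
  on_curve j (weierstrass c) Q -> on_curve j (weierstrass c) (add_pt P Q).
Proof.
move=> hP hQ; rewrite /add_pt; case: ifPn => // nP; case: ifPn => // nQ.
have [x1 [y1 [-> e1]]] := on_weierstrassP hP nP.
have [x2 [y2 [-> e2]]] := on_weierstrassP hQ nQ.
rewrite !affptE; case: ifPn => [nx|/negPn/eqP ex].
  rewrite on_weierstrass_aff; apply/eqP.
  have d : x2 - x1 != 0 by rewrite subr_eq0 eq_sym.
  have -> : j c = y1 ^+ 2 - x1 ^+ 3 by rewrite e1; ring.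
  have e : y2 ^+ 2 = x2 ^+ 3 + y1 ^+ 2 - x1 ^+ 3 by rewrite e1 e2; ring.
  set l := (y2 - y1) / (x2 - x1).
  have hl : l * (x2 - x1) = y2 - y1 by rewrite divfK.
  have y2E : y2 = y1 + l * (x2 - x1) by rewrite hl; ring.
  have h : l ^+ 2 * (x2 - x1) + 2 * l * y1 = x1 ^+ 2 + x1 * x2 + x2 ^+ 2.
    apply: (mulIf d); apply/eqP; rewrite -subr_eq0; move/eqP: e.
    by rewrite -subr_eq0 y2E => /eqP e; rewrite -[eqbRHS]e; apply/eqP; ring.
  apply/eqP; rewrite -subr_eq0; apply/eqP; move/eqP: h; rewrite -subr_eq0.
  move/eqP/(congr1 ( *%R (l ^+ 2 - 2 * x1 - x2))); rewrite mulr0 => <-; ring.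
subst x2; case: ifPn => [_|ny]; first exact: on_weierstrass0.
have yy : y2 = y1.
  have : (y1 - y2) * (y1 + y2) == 0 by rewrite -subr_sqr e1 e2 subrr.
  by rewrite mulf_eq0 subr_eq0 addr_eq0 (negPf ny) orbF => /eqP.
subst y2; have d : 2 * y1 != 0.
  by rewrite mulr_natl mulr2n addr_eq0.
rewrite on_weierstrass_aff; apply/eqP.
set l := _ / _; have h : l * (2 * y1) = 3 * x1 ^+ 2 by rewrite divfK.
apply/eqP; rewrite -subr_eq0; apply/eqP; move/eqP: h; rewrite -subr_eq0.
have -> : j c = y1 ^+ 2 - x1 ^+ 3 by rewrite e1; ring.
move/eqP/(congr1 ( *%R (l ^+ 2 - 3 * x1))); rewrite mulr0 => <-; ring.
Qed.

Definition ec_neg (P : EC) : EC :=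
  exist (on_curve j (weierstrass c)) _
    (neg_pt_on (valP P)).
Definition ec_add (P Q : EC) : EC :=
  exist (on_curve j (weierstrass c)) _
    (add_pt_on (valP P) (valP Q)).

End EllipticCurve.

(* ------------------------------------------------------------------------ *)
(*  Galois cohomology with coefficients in E(ks) and in its submodules      *)
(* ------------------------------------------------------------------------ *)

Section Cohomology.
Variables (k ks : fieldType) (iota : {rmorphism k -> ks}) (c : k).
Local Notation G := (Gal iota).
Local Notation E := (EC c iota).

Lemma pivot_gal (s : G) (v : 'rV[ks]_3) :
  pivot v == 1 -> pivot (map_mx s v) == 1.
Proof.
rewrite /pivot !mxE !fmorph_eq0.
by case: ifP => _; [|case: ifP => _] => /eqP ->; rewrite rmorph1.
Qed.

Definition gal_pt (s : G) (P : P2 ks) : P2 ks :=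
  exist (fun v => pivot v == 1) _ (pivot_gal s (valP P)).

Lemma gal_pt_on (s : G) (P : P2 ks) :
  on_curve iota (weierstrass c) P -> on_curve iota (weierstrass c) (gal_pt s P).
Proof.
rewrite !on_weierstrassE /pX /pY /pZ /= !mxE => /eqP e; apply/eqP.
by rewrite -[iota c](gal_fix s) -!(rmorphXn, rmorphM, rmorphD) /= e.
Qed.

Definition gal_ec (s : G) (P : E) : E :=
  exist (on_curve iota (weierstrass c)) _ (gal_pt_on s (valP P)).

(* Continuous 1-cocycles with values in a Galois submodule A of E(ks). *)
Record Z1 (A : {pred E}) := MkZ1 {
  z1_fun :> G -> E;
  z1_in : forall s, z1_fun s \in A;
  z1_cont : gal_continuous z1_fun;
  z1_cocycle : forall s t,
    z1_fun (gal_mul s t) = ec_add (z1_fun s) (gal_ec s (z1_fun t)) }.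

Definition cohomologous (A : {pred E}) (f g : Z1 A) : Prop :=
  exists2 m : E, m \in A &
    forall s, ec_add (f s) (ec_neg (g s)) = ec_add (gal_ec s m) (ec_neg m).

(* H^1(G, A), each element being a class of cohomologous cocycles. *)
Definition H1 (A : {pred E}) :=
  {X : Z1 A -> Prop | exists f, X = cohomologous f}.

Definition h1_class (A : {pred E}) (f : Z1 A) : H1 A :=
  exist _ (cohomologous f) (ex_intro _ f erefl).

Definition h1_repr (A : {pred E}) (xi : H1 A) : Z1 A :=
  proj1_sig (constructive_indefinite_description _ (proj2_sig xi)).

Definition z1_incl (A B : {pred E}) (AB : {subset A <= B}) (f : Z1 A) : Z1 B :=
  MkZ1 (fun s => AB _ (z1_in f s)) (@z1_cont _ f) (z1_cocycle f).

(* The map induced by an inclusion of coefficients A <= B, computed on a chosen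
   representative; cohomologous cocycles have the same image. *)
Definition h1_incl (A B : {pred E}) (AB : {subset A <= B}) (xi : H1 A) : H1 B :=
  h1_class (z1_incl AB (h1_repr xi)).

Definition H1E := H1 predT.

End Cohomology.

(* ------------------------------------------------------------------------ *)
(*  Principal homogeneous spaces                                            *)
(* ------------------------------------------------------------------------ *)

Section PHS.
Variables (k : fieldType) (c : k).

(* The smooth plane curve F = 0 with the action mu of E : Y^2 = X^3 + c, both
   over k. Simple transitivity is required on points in every extension field
   of k, i.e. the map F x E -> F x F, (p, P) |-> (p, mu(p, P)) is bijective on
   L-points for every L; on geometric points only, this would fail to exclude
   purely inseparable maps. *)
Record is_phs (F : {mpoly k[3]}) (mu : bimap k) : Prop := IsPHS {
  phs_smooth : smooth_plane_curve F;
  phs_morphism : is_bimorphism F (weierstrass c) F mu;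
  phs_act0 : forall (L : fieldType) (j : {rmorphism k -> L}) (p : P2 L),
    on_curve j F p -> biapp j mu p (val (ec0 c j)) = p;
  phs_actD : forall (L : fieldType) (j : {rmorphism k -> L}) (p : P2 L)
      (P Q : EC c j), on_curve j F p ->
    biapp j mu (biapp j mu p (val P)) (val Q) = biapp j mu p (val (ec_add P Q));
  phs_simply_transitive :
    forall (L : fieldType) (j : {rmorphism k -> L}) (p q : P2 L),
      on_curve j F p -> on_curve j F q ->
      exists! P : EC c j, biapp j mu p (val P) = q }.

Variables (ks : fieldType) (iota : {rmorphism k -> ks}).

(* xi is the class of s |-> s(p0) - p0, where p0 is a ks-point of the curve and
   q - p is the unique point P of E with mu(p, P) = q. *)
Definition has_phs_class (F : {mpoly k[3]}) (mu : bimap k) (xi : H1E iota c) :=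
  exists2 p0 : P2 ks, on_curve iota F p0 &
  exists2 f : Z1 predT,
    forall s : Gal iota, biapp iota mu p0 (val (f s)) = gal_pt s p0 &
    xi = h1_class f.

Definition phs_curve_of (xi : H1E iota c) (F : {mpoly k[3]}) : Prop :=
  exists2 mu, is_phs F mu & has_phs_class F mu xi.

End PHS.

(* ------------------------------------------------------------------------ *)
(*  The curve Z^3 = a X^3 + b Y^3, the module T, and the cocycles gamma_t   *)
(* ------------------------------------------------------------------------ *)

Definition cubicC (k : fieldType) (a b : k) : {mpoly k[3]} :=
  'X_2 ^+ 3 - a *: 'X_0 ^+ 3 - b *: 'X_1 ^+ 3.

Definition jac_coef (k : fieldType) (a b : k) : k :=
  - (27 / 4) * a ^+ 2 * b ^+ 2.

Lemma jac_coef_neq0 (k : fieldType) (a b : k) : 2%N \notin [pchar k] ->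
  3%N \notin [pchar k] -> a != 0 -> b != 0 -> jac_coef a b != 0.
Proof.
rewrite !inE /= => h2 h3 ha hb.
have -> : jac_coef a b = - (3 ^+ 3 / 2 ^+ 2 * a ^+ 2 * b ^+ 2).
  by rewrite /jac_coef -!natrX !mulNr.
by rewrite oppr_eq0 !mulf_neq0 ?invr_eq0 ?expf_eq0.
Qed.

Section Torsion.
Variables (k ks : fieldType) (iota : {rmorphism k -> ks}) (c : k).
Variables (sqrtc : ks) (hsqrtc : sqrtc ^+ 2 = iota c).
Local Notation E := (EC c iota).

Lemma torsP_on : on_curve iota (weierstrass c) (affpt 0 sqrtc).
Proof. by rewrite on_weierstrass_aff hsqrtc expr0n add0r. Qed.

Definition torsP : E := exist (on_curve iota (weierstrass c)) _ torsP_on.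

Definition T3 : {pred E} :=
  [pred Q : E | [|| Q == ec0 c iota, Q == torsP | Q == ec_neg torsP]].

Lemma T3_sub : {subset T3 <= predT}.
Proof. by []. Qed.

Definition Psi : H1 T3 -> H1E iota c := h1_incl T3_sub.

Variables (omega epsilon : ks).

Definition gamma_fun (s : Gal iota) : E :=
  if s epsilon == epsilon then ec0 c iota
  else if s epsilon == omega * epsilon then torsP else ec_neg torsP.

Lemma gamma_in s : gamma_fun s \in T3.
Proof.
rewrite /gamma_fun; case: ifP => _; first exact/or3P/Or31/eqxx.
by case: ifP => _; apply/or3P; [apply/Or32/eqxx | apply/Or33/eqxx].
Qed.

Lemma gamma_cont : gal_continuous gamma_fun.
Proof.
move=> s; exists [:: epsilon] => t; rewrite /gamma_fun => st.
by rewrite (st epsilon) // mem_head.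
Qed.

Hypotheses (h2 : 2%N \notin [pchar k]) (hc : c != 0).
Hypotheses (homega : 3.-primitive_root omega) (sqrtD : k).
Hypothesis hsqrt : sqrtc = 3 * (2 * omega + 1) * iota sqrtD.
Variables (t : k) (heps : epsilon ^+ 3 = iota t).

Let O := ec0 c iota.
Let P := torsP.
Let N := ec_neg torsP.

Let negE x y : neg_pt (affpt x y) = affpt x (- y) :> P2 ks.
Proof. by rewrite /neg_pt (negPf (affpt_neq0 _ _)) !affptE. Qed.

Let sqrtc_neqN : (sqrtc == - sqrtc) = false.
Proof.
apply/negP; rewrite -addr_eq0 -mulr2n -mulr_natl mulf_eq0 => /orP[].
  by move: h2; rewrite inE /= -(fmorph_eq0 iota) rmorph_nat => /negPf ->.
by rewrite -sqrf_eq0 hsqrtc fmorph_eq0 (negPf hc).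
Qed.

Let addaff0 x y1 y2 : add_pt (affpt x y1) (affpt x y2) =
  if y1 == - y2 then pt0 ks
  else affpt ((3 * x ^+ 2 / (2 * y1)) ^+ 2 - x - x)
         ((3 * x ^+ 2 / (2 * y1))
          * (x - ((3 * x ^+ 2 / (2 * y1)) ^+ 2 - x - x)) - y1).
Proof. by rewrite /add_pt !(negPf (affpt_neq0 _ _)) !affptE eqxx. Qed.

Let tors_add : [/\ ec_add P P = N, ec_add N N = P, ec_add P N = O
  & ec_add N P = O].
Proof.
split; apply: val_inj; rewrite /= ?negE addaff0 expr0n /= mulr0
  !mul0r expr0n /= !subr0 sub0r.
- by rewrite sqrtc_neqN.
- by rewrite opprK eq_sym sqrtc_neqN.
- by rewrite opprK eqxx.
- by rewrite eqxx.
Qed.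

Let add0E (Q : E) : ec_add O Q = Q.
Proof. by apply: val_inj; rewrite /= /add_pt eqxx. Qed.

Let addE0 (Q : E) : ec_add Q O = Q.
Proof. by apply: val_inj; rewrite /= /add_pt eqxx; case: ifP => // /eqP ->. Qed.

Let gal_aff (s : Gal iota) x y : gal_pt s (affpt x y) = affpt (s x) (s y).
Proof.
by apply: P2_inj; rewrite affptE /pX /pY /pZ /= mxE -/(pX _) -/(pY _) -/(pZ _)
  affptE ?rmorph1.
Qed.

Let galO (s : Gal iota) : gal_ec s O = O.
Proof.
by apply: val_inj; apply: P2_inj; rewrite /pX /pY /pZ /= mxE !vec3E
  ?rmorph0 ?rmorph1.
Qed.

Let omega3 : omega ^+ 3 = 1.
Proof. exact: prim_expr_order homega. Qed.

Let omega_neq1 : omega != 1.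
Proof. by rewrite -[omega]expr1 -(prim_order_dvd homega). Qed.

Let omega_rel : omega ^+ 2 = - omega - 1.
Proof.
have d : omega - 1 != 0 by rewrite subr_eq0.
apply: (mulIf d); apply/eqP; rewrite -subr_eq0; apply/eqP.
by transitivity (omega ^+ 3 - 1); [ring | rewrite omega3 subrr].
Qed.

Let gal_omega (s : Gal iota) :
  (s omega = omega /\ s sqrtc = sqrtc) \/
  (s omega = omega ^+ 2 /\ s sqrtc = - sqrtc).
Proof.
have e : (s omega - omega) * (s omega - omega ^+ 2) == 0.
  have r := congr1 s omega_rel.
  rewrite !(rmorphXn, rmorphB, rmorphN, rmorph1) /= in r.
  apply/eqP; transitivity (s omega ^+ 2 - (omega + omega ^+ 2) * s omega
    + omega ^+ 3); first by ring.
  by rewrite r omega3 omega_rel; ring.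
have sq : s sqrtc = 3 * (2 * s omega + 1) * iota sqrtD.
  by rewrite hsqrt !(rmorphM, rmorphD, rmorph1, rmorph_nat) gal_fix.
move: e; rewrite mulf_eq0 !subr_eq0 => /orP[]/eqP e; [left|right]; split => //.
  by rewrite sq e hsqrt.
by rewrite sq e omega_rel hsqrt; ring.
Qed.

Let gal_eps (s : Gal iota) : epsilon != 0 ->
  [\/ s epsilon = epsilon /\ gamma_fun s = O,
      s epsilon = omega * epsilon /\ gamma_fun s = P
    | s epsilon = omega ^+ 2 * epsilon /\ gamma_fun s = N].
Proof.
move=> e0; rewrite /gamma_fun; case: ifPn => [/eqP|n1]; first by constructor 1.
case: ifPn => [/eqP|n2]; [by constructor 2 | constructor 3; split=> //].
have h : s epsilon ^+ 3 = epsilon ^+ 3.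
  by rewrite -rmorphXn /= heps gal_fix.
have : (s epsilon - epsilon) * (s epsilon - omega * epsilon)
    * (s epsilon - omega ^+ 2 * epsilon) == 0.
  apply/eqP; transitivity (s epsilon ^+ 3 - omega ^+ 3 * epsilon ^+ 3
     - (1 + omega + omega ^+ 2)
       * (s epsilon ^+ 2 * epsilon - omega * s epsilon * epsilon ^+ 2)).
    by ring.
  by rewrite h omega3 omega_rel; ring.
by rewrite !mulf_eq0 !subr_eq0 (negPf n1) (negPf n2) => /eqP.
Qed.

Lemma gamma_cocycle s u :
  gamma_fun (gal_mul s u) = ec_add (gamma_fun s) (gal_ec s (gamma_fun u)).
Proof.
have [e0|e0] := eqVneq epsilon 0.
  by rewrite /gamma_fun e0 !rmorph0 eqxx galO add0E.
have [PP NN PN NP] := tors_add.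
have galP : (s omega = omega /\ gal_ec s P = P /\ gal_ec s N = N) \/
    (s omega = omega ^+ 2 /\ gal_ec s P = N /\ gal_ec s N = P).
  have [[so sc]|[so sc]] := gal_omega s; [left|right]; do !split=> //;
    by apply: val_inj; rewrite /= ?negE gal_aff ?rmorphN /= rmorph0 sc ?opprK.
have key (l : nat) : s (u epsilon) = omega ^+ l * epsilon ->
  gamma_fun (gal_mul s u) = nth O [:: O; P; N] (l %% 3)%N.
  have w i : omega ^+ l * epsilon = omega ^+ i * epsilon -> (l %% 3 = i %% 3)%N.
    by move=> /(mulIf e0)/eqP; rewrite (eq_prim_root_expr homega) => /eqP.
  move=> hl; have [[e ->]|[e ->]|[e ->]] := gal_eps (gal_mul s u) e0.
  - by rewrite (w 0%N) // -hl mul1r.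
  - by rewrite (w 1%N) // -hl expr1.
  - by rewrite (w 2%N) // -hl.
have [[us ->]|[us ->]|[us ->]] := gal_eps u e0;
  have [[es ->]|[es ->]|[es ->]] := gal_eps s e0;
  have [[so [sP sN]]|[so [sP sN]]] := galP;
  rewrite ?galO ?sP ?sN ?add0E ?addE0 ?PP ?NN ?PN ?NP;
  let go m := solve [rewrite (key m) // us ?rmorphM ?rmorphXn /= ?so es; ring] in
  first [go 0%N | go 1%N | go 2%N | go 3%N | go 4%N | go 5%N | go 6%N].
Qed.

Definition gamma : Z1 T3 := MkZ1 gamma_in gamma_cont gamma_cocycle.

End Torsion.

Arguments Psi {k ks iota c sqrtc} hsqrtc xi.

(* Main.v *)
Require Import Defs.
From mathcomp Require Import all_boot all_order all_algebra all_field.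
From mathcomp Require Import mpoly.
From mathcomp Require Import ring.
From Stdlib Require Import IndefiniteDescription.

Set Implicit Arguments.
Unset Strict Implicit.
Unset Printing Implicit Defensive.

Import GRing.Theory.
Local Open Scope ring_scope.

(* With d = ab/2, the linear change of coordinates
   (U : V : W) = (9dz + y : 9dz - y : 3x) turns E into U^3 + V^3 = ab W^3, the
   origin becoming the flex (1 : -1 : 0). For p on C and P on E, the point
   q = p + P is cut out by three equations that are linear in each of p, P and
   q (see [tri]). As equations in q they form a 3 x 3 matrix whose determinant
   vanishes on C x E and whose rank is exactly 2 there, so that the cross
   products of its rows are bihomogeneous formulas for the action, and one of
   them is nonzero at every point. As equations in P they have rank 2 on C x C,
   which gives simple transitivity. Compatibility with the chord-and-tangent law
   is a finite list of polynomial identities modulo the equations of the curves.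
   The points of T have W = 0 and act by diagonal matrices with cube roots of
   unity as entries; this is exactly how the Galois group moves (eps : 1 : 0),
   (1 : 0 : eps) and (0 : 1 : eps) for t = -b/a, a and b. Changing the sign of
   y replaces a class by its opposite, and the case t = b needs the sign
   opposite to the one of the other two cases. *)

(** * Trilinear relations for the action, over a commutative ring *)

Section Vectors.
Variable R : comNzRingType.
Implicit Types u v p q P Q : 'rV[R]_3.

(** Same shape as [vec3], but over any commutative ring, because the formulas for the action have
    polynomial entries. *)
Definition row3 (x y z : R) : 'rV[R]_3 := \row_(i < 3) [:: x; y; z]`_i.

Lemma row3E x y z :
  (row3 x y z 0 0 = x) * (row3 x y z 0 1 = y) * (row3 x y z 0 2 = z).
Proof. by rewrite !mxE. Qed.

Lemma row3_eta v : v = row3 (v 0 0) (v 0 1) (v 0 2).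
Proof.
apply/rowP => i; rewrite mxE.
by case: i => [[|[|[|//]]] Hi] /=; congr (v _ _); apply: val_inj.
Qed.

Lemma row3P u v :
  [/\ u 0 0 = v 0 0, u 0 1 = v 0 1 & u 0 2 = v 0 2] -> u = v.
Proof. by case=> e0 e1 e2; rewrite [u]row3_eta [v]row3_eta e0 e1 e2. Qed.

Definition dot u v := u 0 0 * v 0 0 + u 0 1 * v 0 1 + u 0 2 * v 0 2.

Definition cross u v := row3 (u 0 1 * v 0 2 - u 0 2 * v 0 1)
  (u 0 2 * v 0 0 - u 0 0 * v 0 2) (u 0 0 * v 0 1 - u 0 1 * v 0 0).

Definition diag_cubic (A B D : R) v :=
  A * v 0 0 ^+ 3 + B * v 0 1 ^+ 3 + D * v 0 2 ^+ 3.

(* These are the multilinearised relations of a Sklyanin algebra: on the curve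
   A x^3 + B y^3 + D z^3 = 0, acted on by its Jacobian
   U^3 + V^3 + A B D W^3 = 0 with origin (1 : -1 : 0), they cut out the graph
   of the action, that is, [tri A B D p P q] means q = p + P. *)
Definition tri (A B D : R) p P q :=
  [/\ P 0 0 * p 0 1 * q 0 2 + P 0 1 * p 0 2 * q 0 1
        + A * P 0 2 * p 0 0 * q 0 0 = 0,
      P 0 0 * p 0 2 * q 0 0 + P 0 1 * p 0 0 * q 0 2
        + B * P 0 2 * p 0 1 * q 0 1 = 0
    & P 0 0 * p 0 0 * q 0 1 + P 0 1 * p 0 1 * q 0 0
        + D * P 0 2 * p 0 2 * q 0 2 = 0].

(* The equations [tri A B D p P q] as linear forms in q. Index 3 is sent back to
   the first equation, so that [i] and [i.+1] run through the cyclic pairs. *)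
Definition tri_eqn (A B D : R) p P (i : nat) : 'rV[R]_3 :=
  match i with
  | 1 => row3 (P 0 0 * p 0 2) (B * P 0 2 * p 0 1) (P 0 1 * p 0 0)
  | 2 => row3 (P 0 1 * p 0 1) (P 0 0 * p 0 0) (D * P 0 2 * p 0 2)
  | _ => row3 (A * P 0 2 * p 0 0) (P 0 1 * p 0 2) (P 0 0 * p 0 1)
  end.

(* The same equations as linear forms in P. *)
Definition tri_eqn_diff (A B D : R) p q (i : nat) : 'rV[R]_3 :=
  match i with
  | 1 => row3 (p 0 2 * q 0 0) (p 0 0 * q 0 2) (B * p 0 1 * q 0 1)
  | 2 => row3 (p 0 0 * q 0 1) (p 0 1 * q 0 0) (D * p 0 2 * q 0 2)
  | _ => row3 (p 0 1 * q 0 2) (p 0 2 * q 0 1) (A * p 0 0 * q 0 0)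
  end.

Definition tri_sol A B D p P i :=
  cross (tri_eqn A B D p P i) (tri_eqn A B D p P i.+1).
Definition tri_diff A B D p q i :=
  cross (tri_eqn_diff A B D p q i) (tri_eqn_diff A B D p q i.+1).

Lemma tri_eqnP A B D p P q :
  tri A B D p P q <-> forall i, dot (tri_eqn A B D p P i) q = 0.
Proof.
rewrite /tri /dot; split=> [[e0 e1 e2] i|e].
  case: i => [|[|[|i]]]; rewrite /tri_eqn /= !row3E.
  - by rewrite -[RHS]e0; ring.
  - by rewrite -[RHS]e1; ring.
  - by rewrite -[RHS]e2; ring.
  - by rewrite -[RHS]e0; ring.
by split; [move: (e 0%N) | move: (e 1%N) | move: (e 2%N)];
  rewrite /tri_eqn /= !row3E => <-; ring.
Qed.

Lemma tri_eqn_diffP A B D p P q :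
  tri A B D p P q <-> forall i, dot (tri_eqn_diff A B D p q i) P = 0.
Proof.
rewrite /tri /dot; split=> [[e0 e1 e2] i|e].
  case: i => [|[|[|i]]]; rewrite /tri_eqn_diff /= !row3E.
  - by rewrite -[RHS]e0; ring.
  - by rewrite -[RHS]e1; ring.
  - by rewrite -[RHS]e2; ring.
  - by rewrite -[RHS]e0; ring.
by split; [move: (e 0%N) | move: (e 1%N) | move: (e 2%N)];
  rewrite /tri_eqn_diff /= !row3E => <-; ring.
Qed.

Lemma triZ A B D l m n p P q :
  tri A B D p P q -> tri A B D (l *: p) (m *: P) (n *: q).
Proof.
case=> e0 e1 e2; rewrite /tri !mxE; split.
- by rewrite -[RHS](mulr0 (l * m * n)) -e0; ring.
- by rewrite -[RHS](mulr0 (l * m * n)) -e1; ring.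
- by rewrite -[RHS](mulr0 (l * m * n)) -e2; ring.
Qed.

Lemma triZr A B D n p P q : tri A B D p P q -> tri A B D p P (n *: q).
Proof. by move=> /(triZ 1 1 n); rewrite !scale1r. Qed.

Lemma triZm A B D m p P q : tri A B D p P q -> tri A B D p (m *: P) q.
Proof. by move=> /(triZ 1 m 1); rewrite !scale1r. Qed.

(** This is inversion on U^3 + V^3 + A B D W^3 = 0 with origin the flex (1 : -1 : 0): the point, its
    image and the origin are collinear. *)
Definition swap12 v := row3 (v 0 1) (v 0 0) (v 0 2).

Lemma tri_sym A B D p P q : tri A B D p P q -> tri A B D q (swap12 P) p.
Proof.
by case=> e0 e1 e2; rewrite /tri !row3E; split;
  [rewrite -[RHS]e0 | rewrite -[RHS]e1 | rewrite -[RHS]e2]; ring.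
Qed.

Lemma diag_cubic_swap12 D v :
  diag_cubic 1 1 D (swap12 v) = diag_cubic 1 1 D v.
Proof. by rewrite /diag_cubic !row3E; ring. Qed.

Lemma tri_row3 A B D x y z U V W x' y' z' :
  tri A B D (row3 x y z) (row3 U V W) (row3 x' y' z') =
  [/\ U * y * z' + V * z * y' + A * W * x * x' = 0,
      U * z * x' + V * x * z' + B * W * y * y' = 0
    & U * x * y' + V * y * x' + D * W * z * z' = 0].
Proof. by rewrite /tri !row3E. Qed.

(** From index 3 on, both rows are the first equation, so that their cross product is 0. *)
Lemma tri_sol_row3 A B D x y z U V W i :
  tri_sol A B D (row3 x y z) (row3 U V W) i =
  match i with
  | 0 => row3 (V ^+ 2 * x * z - B * U * W * y ^+ 2)
           (U ^+ 2 * y * z - A * V * W * x ^+ 2)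
           (A * B * W ^+ 2 * x * y - U * V * z ^+ 2)
  | 1 => row3 (B * D * W ^+ 2 * y * z - U * V * x ^+ 2)
           (V ^+ 2 * x * y - D * U * W * z ^+ 2)
           (U ^+ 2 * x * z - B * V * W * y ^+ 2)
  | 2 => row3 (U ^+ 2 * x * y - D * V * W * z ^+ 2)
           (A * D * W ^+ 2 * x * z - U * V * y ^+ 2)
           (V ^+ 2 * y * z - A * U * W * x ^+ 2)
  | _ => 0
  end.
Proof.
by case: i => [|[|[|i]]]; apply: row3P;
  rewrite /tri_sol /tri_eqn /cross /= !row3E ?mxE; split; ring.
Qed.

(** A cross product is orthogonal to its two rows. Its product with the remaining row is, up to
    sign, the determinant of the relations, which vanishes modulo the two cubic equations; so does
    the cubic form at the solution. *)
Lemma tri_sol_on A B D p P i : diag_cubic A B D p = 0 ->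
  diag_cubic 1 1 (A * B * D) P = 0 ->
  tri A B D p P (tri_sol A B D p P i) /\
  diag_cubic A B D (tri_sol A B D p P i) = 0.
Proof.
rewrite [p]row3_eta [P]row3_eta.
move: (p 0 0) (p 0 1) (p 0 2) (P 0 0) (P 0 1) (P 0 2) => x y z U V W.
rewrite /diag_cubic tri_sol_row3 !row3E !mul1r => ep eP.
(* [ring] uses each curve equation as a rewrite rule for one monomial; [D] stays next to [z ^+ 3]
   because a ring does not allow division by it. *)
have {}ep : D * z ^+ 3 = - A * x ^+ 3 - B * y ^+ 3.
  by rewrite -[LHS]subr0 -[0]ep; ring.
have {}eP : U ^+ 3 = - V ^+ 3 - A * B * D * W ^+ 3.
  by rewrite -[LHS]subr0 -[0]eP; ring.
case: i => [|[|[|i]]]; rewrite ?tri_row3 ?row3E; try by do ?split; ring: ep eP.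
by rewrite /tri !mxE; do ?split; ring.
Qed.

Lemma tri_diff_tri A B D p q i : diag_cubic A B D p = 0 ->
  diag_cubic A B D q = 0 -> tri A B D p (tri_diff A B D p q i) q.
Proof.
rewrite [p]row3_eta [q]row3_eta.
move: (p 0 0) (p 0 1) (p 0 2) (q 0 0) (q 0 1) (q 0 2) => x y z x' y' z'.
rewrite /diag_cubic /tri /tri_diff /cross !row3E => ep eq.
have {}ep : D * z ^+ 3 = - A * x ^+ 3 - B * y ^+ 3.
  by rewrite -[LHS]subr0 -[0]ep; ring.
have {}eq : D * z' ^+ 3 = - A * x' ^+ 3 - B * y' ^+ 3.
  by rewrite -[LHS]subr0 -[0]eq; ring.
case: i => [|[|[|i]]]; rewrite /tri_eqn_diff /= !row3E; split;
  ring: ep eq.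
Qed.

Lemma tri_diff_on A B D p q i : diag_cubic A B D p = 0 ->
  diag_cubic A B D q = 0 ->
  diag_cubic 1 1 (A * B * D) (tri_diff A B D p q i) = 0.
Proof.
rewrite [p]row3_eta [q]row3_eta.
move: (p 0 0) (p 0 1) (p 0 2) (q 0 0) (q 0 1) (q 0 2) => x y z x' y' z'.
rewrite /diag_cubic /tri_diff /cross !row3E !mul1r => ep eq.
(* The cofactors come from replacing d by f(p) - a - b and d' by
   f(q) - a' - b' in the first case; the other two are cyclic shifts. *)
pose m := x * y * z; pose m' := x' * y' * z'.
pose a := A * x ^+ 3; pose b := B * y ^+ 3; pose d := D * z ^+ 3.
pose a' := A * x' ^+ 3; pose b' := B * y' ^+ 3; pose d' := D * z' ^+ 3.
case: i => [|[|[|i]]]; rewrite /tri_eqn_diff /= !row3E; last by ring.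
- transitivity ((a' + b' + d') * (z ^+ 3 * (a * a' + b * b')
        + a * b * z' ^+ 3 - 3 * (A * B) * m ^+ 2 * m')
      - (a + b + d) * (z' ^+ 3 * (a * a' + b * b')
        + a' * b' * z ^+ 3 - 3 * (A * B) * m * m' ^+ 2)).
    by rewrite /m /m' /a /b /d /a' /b' /d'; ring.
  by rewrite ep eq !mul0r subrr.
- transitivity ((a' + b' + d') * (x ^+ 3 * (b * b' + d * d')
        + b * d * x' ^+ 3 - 3 * (B * D) * m ^+ 2 * m')
      - (a + b + d) * (x' ^+ 3 * (b * b' + d * d')
        + b' * d' * x ^+ 3 - 3 * (B * D) * m * m' ^+ 2)).
    by rewrite /m /m' /a /b /d /a' /b' /d'; ring.
  by rewrite ep eq !mul0r subrr.
- transitivity ((a' + b' + d') * (y ^+ 3 * (a * a' + d * d')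
        + a * d * y' ^+ 3 - 3 * (A * D) * m ^+ 2 * m')
      - (a + b + d) * (y' ^+ 3 * (a * a' + d * d')
        + a' * d' * y ^+ 3 - 3 * (A * D) * m * m' ^+ 2)).
    by rewrite /m /m' /a /b /d /a' /b' /d'; ring.
  by rewrite ep eq !mul0r subrr.
Qed.

(** Starting from the middle point q makes everything explicit: p = q - P, r = q + Q and R = P + Q
    are given by formulas, the last one because the Jacobian acts on itself by the same relations
    with coefficients 1, 1, A B D. Then p + R = r is a polynomial identity for each choice of
    formulas. *)
Lemma tri_assoc_sol A B D P q Q i j l : diag_cubic A B D q = 0 ->
  diag_cubic 1 1 (A * B * D) P = 0 -> diag_cubic 1 1 (A * B * D) Q = 0 ->
  (i < 3)%N -> (j < 3)%N -> (l < 3)%N ->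
  tri A B D (tri_sol A B D q (swap12 P) i)
    (tri_sol 1 1 (A * B * D) P Q l) (tri_sol A B D q Q j).
Proof.
rewrite [q]row3_eta [P]row3_eta [Q]row3_eta.
move: (q 0 0) (q 0 1) (q 0 2) => x y z.
move: (P 0 0) (P 0 1) (P 0 2) (Q 0 0) (Q 0 1) (Q 0 2) => U V W U' V' W'.
rewrite /diag_cubic /swap12 !row3E !tri_sol_row3 !mul1r => eq eP eQ.
have {}eq : D * z ^+ 3 = - A * x ^+ 3 - B * y ^+ 3.
  by rewrite -[LHS]subr0 -[0]eq; ring.
have {}eP : U ^+ 3 = - V ^+ 3 - A * B * D * W ^+ 3.
  by rewrite -[LHS]subr0 -[0]eP; ring.
have {}eQ : U' ^+ 3 = - V' ^+ 3 - A * B * D * W' ^+ 3.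
  by rewrite -[LHS]subr0 -[0]eQ; ring.
by case: i => [|[|[|//]]] _; case: j => [|[|[|//]]] _;
  case: l => [|[|[|//]]] _; rewrite tri_row3; split; ring: eq eP eQ.
Qed.

End Vectors.

(** * Rank of the relations over a field *)

Section TriField.
Variable L : fieldType.
Implicit Types u v w p q P Q : 'rV[L]_3.

Lemma row3_neq0 (x y z : L) :
  row3 x y z != 0 -> ~ [/\ x = 0, y = 0 & z = 0].
Proof.
move=> /eqP n [x0 y0 z0]; apply: n; apply: row3P.
by rewrite !row3E !mxE x0 y0 z0.
Qed.

Lemma cross_eq0 u v : cross u v = 0 -> v != 0 -> exists l, u = l *: v.
Proof.
move=> /rowP e nv; have := e 0; have := e 1; have := e 2.
rewrite /cross !row3E !mxE => /eqP; rewrite subr_eq0 => /eqP e2.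
move=> /eqP; rewrite subr_eq0 => /eqP e1 /eqP; rewrite subr_eq0 => /eqP e0.
have [i ni] : exists i, v 0 i != 0.
  apply/existsP; apply: contraR nv; rewrite negb_exists => /forallP v0.
  by apply/eqP/rowP => i; rewrite mxE; apply/eqP; move: (v0 i); rewrite negbK.
exists (u 0 i / v 0 i); apply: row3P; rewrite !mxE.
have sol j : u 0 j * v 0 i = u 0 i * v 0 j -> u 0 j = u 0 i / v 0 i * v 0 j.
  by move=> eij; apply: (mulIf ni); rewrite eij mulrAC divfK.
have: i \in [:: 0; 1; 2].
  by case: (i) => [[|[|[|//]]] ?]; rewrite !inE /eq_op /=.
by rewrite !inE => /or3P[]/eqP i_eq; split; apply: sol; rewrite i_eq // ;
  first [rewrite e0 | rewrite e1 | rewrite e2 | rewrite -e0 | rewrite -e1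
    | rewrite -e2]; ring.
Qed.

(** By the identity u x (r x s) = (s . u) r - (r . u) s. *)
Lemma cross_perp u r s : dot r u = 0 -> dot s u = 0 -> cross u (cross r s) = 0.
Proof.
rewrite /dot => er es; apply: row3P; rewrite /cross !row3E !mxE; split.
- by transitivity (r 0 0 * 0 - s 0 0 * 0); [rewrite -{1}es -er|]; ring.
- by transitivity (r 0 1 * 0 - s 0 1 * 0); [rewrite -{1}es -er|]; ring.
- by transitivity (r 0 2 * 0 - s 0 2 * 0); [rewrite -{1}es -er|]; ring.
Qed.

Section Coefficients.
Variables A B D : L.
Hypotheses (nA : A != 0) (nB : B != 0) (nD : D != 0) (n3 : 3 != 0 :> L).
Let f := diag_cubic A B D.
Let g := diag_cubic 1 1 (A * B * D).
Let T := tri A B D.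

Let mulf_eq0P (x y : L) : x * y = 0 -> x = 0 \/ y = 0.
Proof. by move/eqP; rewrite mulf_eq0 => /orP[]/eqP; [left | right]. Qed.

Let expf_eq0P (x : L) n : x ^+ n.+1 = 0 -> x = 0.
Proof. by move/eqP; rewrite expf_eq0 => /eqP. Qed.

Let sub_eq (x y : L) : x - y = 0 -> x = y.
Proof. by move/eqP; rewrite subr_eq0 => /eqP. Qed.

Let two_cubes (b d y z : L) : b != 0 -> d != 0 ->
  b * y ^+ 3 + d * z ^+ 3 = 0 -> y * z = 0 -> y = 0 /\ z = 0.
Proof.
move=> nb nd e /mulf_eq0P[] h; move: e; rewrite h expr0n mulr0 ?add0r ?addr0.
  by move/eqP; rewrite mulf_eq0 (negPf nd) => /eqP/expf_eq0P.
by move/eqP; rewrite mulf_eq0 (negPf nb) => /eqP/expf_eq0P.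
Qed.

(** If all the minors vanish, they combine to 3 A B D W^2 xyz = UV f(p) = 0, so W = 0 or xyz = 0. If
    W = 0, then UV is nonzero and the squares of x, y, z vanish; if one coordinate of p is 0, a
    minor kills the product of the other two, and f(p) = 0 kills both. Either way p = 0. *)
Lemma tri_sol_neq0 p P : p != 0 -> P != 0 -> f p = 0 -> g P = 0 ->
  exists2 i, (i < 3)%N & tri_sol A B D p P i != 0.
Proof.
rewrite [p]row3_eta [P]row3_eta.
move: (p 0 0) (p 0 1) (p 0 2) (P 0 0) (P 0 1) (P 0 2) => x y z U V W.
move=> /row3_neq0 np /row3_neq0 nP; rewrite /f /g /diag_cubic !row3E => ep eP.
set s := tri_sol _ _ _ _ _.
have [/existsP[i ni]|] := boolP [exists i : 'I_3, s i != 0]; first by exists i.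
rewrite negb_exists => /forallP s0; exfalso.
have {s0} e i : (i < 3)%N -> s i = 0.
  by move=> hi; apply/eqP; move: (s0 (Ordinal hi)); rewrite negbK.
have := e 0%N isT; have := e 1%N isT; have := e 2%N isT; rewrite /s {s e}.
rewrite !tri_sol_row3 => /rowP e2 /rowP e1 /rowP e0.
have := e0 0; have := e0 1; have := e0 2.
have := e1 0; have := e2 1; rewrite !row3E !mxE.
move=> /sub_eq ey /sub_eq ex /sub_eq ez /sub_eq eu /sub_eq ev.
have [W0|nW] := eqVneq W 0.
  have UV0 : U * V != 0.
    apply/eqP => UV; apply: nP; move: eP; rewrite W0 expr0n mulr0 addr0.
    by case/two_cubes; rewrite ?oner_neq0.
  by apply: np; split; apply/eqP; rewrite -sqrf_eq0; apply/eqP;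
    apply: (mulfI UV0); rewrite mulr0 -?ex -?ey -?ez W0; ring.
have nW2 c d : c != 0 -> d != 0 -> c * d * W ^+ 2 != 0.
  by move=> nc nd; rewrite !mulf_neq0.
have [m0|nm] := eqVneq (x * y * z) 0.
  apply: np; case: (mulf_eq0P m0) => [/mulf_eq0P[]|] h0; move: ep;
    rewrite h0 expr0n mulr0 ?add0r ?addr0 => ep.
  - case: (two_cubes nB nD ep) => [|-> ->//].
    by apply: (mulfI (nW2 _ _ nB nD)); rewrite mulr0 mulrA ex h0; ring.
  - case: (two_cubes nA nD ep) => [|-> ->//].
    by apply: (mulfI (nW2 _ _ nA nD)); rewrite mulr0 mulrA ey h0; ring.
  - case: (two_cubes nA nB ep) => [|-> ->//].
    by apply: (mulfI (nW2 _ _ nA nB)); rewrite mulr0 mulrA ez h0; ring.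
have [/mulf_eq0P UV0|nUV] := eqVneq (U * V) 0.
  have [U0 V0] : U = 0 /\ V = 0.
    move: nm; rewrite !mulf_eq0 !negb_or => /andP[/andP[nx ny] nz].
    case: UV0 => h0; split=> //; apply/eqP; rewrite -sqrf_eq0; apply/eqP.
      by apply: (mulIf nx); apply: (mulIf nz); rewrite ev h0; ring.
    by apply: (mulIf ny); apply: (mulIf nz); rewrite eu h0; ring.
  have nABD : A * B * D != 0 by rewrite !mulf_neq0.
  move: eP; rewrite U0 V0 expr0n !mulr0 !add0r.
  move=> /mulf_eq0P[/eqP|/expf_eq0P/eqP].
    by rewrite (negPf nABD).
  by rewrite (negPf nW).
have : 3 * (A * B * D * W ^+ 2 * (x * y * z)) =
    U * V * (A * x ^+ 3 + B * y ^+ 3 + D * z ^+ 3).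
  transitivity (A * x * (U * V * x ^+ 2) + B * y * (U * V * y ^+ 2)
    + D * z * (U * V * z ^+ 2)); last by ring.
  by rewrite -ex -ey -ez; ring.
rewrite ep mulr0 => /eqP.
by apply/negP; rewrite mulf_neq0 // mulf_neq0 // !mulf_neq0.
Qed.

(** Suppose all the minors vanish. If xyz is nonzero, the three terms A x'^3, B y'^3, D z'^3 are
    equal; their sum is 0 and 3 is invertible, hence q = 0. If one coordinate of p is 0, the other
    two are nonzero and force two coordinates of q to vanish, then the third by the cubic
    equation. *)
Lemma tri_diff_neq0 p q : p != 0 -> q != 0 -> f p = 0 -> f q = 0 ->
  exists2 i, (i < 3)%N & tri_diff A B D p q i != 0.
Proof.
rewrite [p]row3_eta [q]row3_eta.
move: (p 0 0) (p 0 1) (p 0 2) (q 0 0) (q 0 1) (q 0 2) => x y z x' y' z'.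
move=> /row3_neq0 np /row3_neq0 nq; rewrite /f /diag_cubic !row3E => ep eq.
set s := tri_diff _ _ _ _ _.
have [/existsP[i ni]|] := boolP [exists i : 'I_3, s i != 0]; first by exists i.
rewrite negb_exists => /forallP s0; exfalso.
have {s0} e i : (i < 3)%N -> s i = 0.
  by move=> hi; apply/eqP; move: (s0 (Ordinal hi)); rewrite negbK.
have := e 0%N isT; have := e 1%N isT; have := e 2%N isT; rewrite /s {s e}.
rewrite /tri_diff /tri_eqn_diff /cross /= !row3E => /rowP e2 /rowP e1 /rowP e0.
have := e0 0; have := e0 1; have := e0 2; have := e1 0; have := e1 1.
have := e1 2; have := e2 0; have := e2 1; have := e2 2; rewrite !row3E !mxE.
move=> /sub_eq e22 /sub_eq e21 /sub_eq e20 /sub_eq e12 /sub_eq e11 /sub_eq e10.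
move=> /sub_eq e02 /sub_eq e01 /sub_eq e00.
have sq0 (c v w : L) : c != 0 -> w != 0 -> c * w * v ^+ 2 = 0 -> v = 0.
  move=> nc nw /mulf_eq0P[/eqP|/expf_eq0P//].
  by rewrite !mulf_eq0 (negPf nc) (negPf nw).
have n0 (b d v w : L) : b != 0 -> d != 0 -> b * v ^+ 3 + d * w ^+ 3 = 0 ->
    ~ (v = 0 /\ w = 0) -> v * w != 0.
  by move=> nb nd e h; apply/eqP => /(two_cubes nb nd e).
have cube0 (c v : L) : c != 0 -> c * v ^+ 3 = 0 -> v = 0.
  by move=> nc /mulf_eq0P[/eqP|/expf_eq0P//]; rewrite (negPf nc).
have [m0|nm] := eqVneq (x * y * z) 0.
  apply: nq; case: (mulf_eq0P m0) => [/mulf_eq0P[]|] h0; move: ep;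
    rewrite h0 expr0n mulr0 ?add0r ?addr0 => ep.
  - have n : y * z != 0 by apply: (n0 _ _ _ _ nB nD ep) => -[y0 z0]; apply: np.
    have y'0 : y' = 0.
      apply: (sq0 B _ _ nB n).
      by transitivity (z * y' * (B * y * y')); [ring | rewrite e00 h0; ring].
    have z'0 : z' = 0.
      apply: (sq0 D _ _ nD n).
      by transitivity (D * z * z' * (y * z')); [ring | rewrite e21 h0; ring].
    split=> //; apply: (cube0 _ _ nA).
    by move: eq; rewrite y'0 z'0 !expr0n !mulr0 !addr0.
  - have n : x * z != 0 by apply: (n0 _ _ _ _ nA nD ep) => -[x0 z0]; apply: np.
    have x'0 : x' = 0.
      apply: (sq0 A _ _ nA n).
      by transitivity (A * x * x' * (z * x')); [ring | rewrite e01 h0; ring].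
    have z'0 : z' = 0.
      apply: (sq0 D _ _ nD n).
      by transitivity (x * z' * (D * z * z')); [ring | rewrite e10 h0; ring].
    split=> //; apply: (cube0 _ _ nB).
    by move: eq; rewrite x'0 z'0 !expr0n !mulr0 addr0 add0r.
  - have n : x * y != 0 by apply: (n0 _ _ _ _ nA nB ep) => -[x0 y0]; apply: np.
    have x'0 : x' = 0.
      apply: (sq0 A _ _ nA n).
      by transitivity (y * x' * (A * x * x')); [ring | rewrite e20 h0; ring].
    have y'0 : y' = 0.
      apply: (sq0 B _ _ nB n).
      by transitivity (B * y * y' * (x * y')); [ring | rewrite e11 h0; ring].
    split=> //; apply: (cube0 _ _ nD).
    by move: eq; rewrite x'0 y'0 !expr0n !mulr0 !add0r.
have cE : A * x ^+ 3 * (x' * y' * z') = x * y * z * (A * x' ^+ 3).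
  transitivity (x * z' * (x * y') * (A * x * x')); first by ring.
  by rewrite -e12; ring.
have bE : x * y * z * (B * y' ^+ 3) = x * y * z * (A * x' ^+ 3).
  transitivity (z * y' * (B * y * y') * (x * y')); first by ring.
  by rewrite e00 -cE; ring.
have dE : x * y * z * (D * z' ^+ 3) = x * y * z * (A * x' ^+ 3).
  transitivity (D * z * z' * (y * z') * (x * z')); first by ring.
  by rewrite e21 -cE; ring.
have x'0 : x' = 0.
  apply: (cube0 (3 * A)); rewrite ?mulf_neq0 //; apply: (mulfI nm).
  rewrite mulr0 -[RHS](mulr0 (x * y * z)) -[X in _ = _ * X]eq !mulrDr bE dE.
  by ring.
apply: nq; split=> //.
  by apply: (cube0 B) => //; apply: (mulfI nm); rewrite bE x'0; ring.
by apply: (cube0 D) => //; apply: (mulfI nm); rewrite dE x'0; ring.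
Qed.

Lemma tri_kernel p P q : p != 0 -> P != 0 -> f p = 0 -> g P = 0 -> T p P q ->
  exists i l, (i < 3)%N /\ q = l *: tri_sol A B D p P i.
Proof.
move=> np nP fp gP /tri_eqnP e; have [i hi si] := tri_sol_neq0 np nP fp gP.
exists i; have [l ->] := cross_eq0 (cross_perp (e i) (e i.+1)) si.
by exists l.
Qed.

Lemma tri_uniq p P q q' : p != 0 -> P != 0 -> f p = 0 -> g P = 0 -> q' != 0 ->
  T p P q -> T p P q' -> exists l, q = l *: q'.
Proof.
move=> np nP fp gP nq' /tri_eqnP e /tri_eqnP e'.
have [i hi si] := tri_sol_neq0 np nP fp gP.
have [l ->] := cross_eq0 (cross_perp (e i) (e i.+1)) si.
have [l' q'E] := cross_eq0 (cross_perp (e' i) (e' i.+1)) si.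
have nl' : l' != 0.
  by apply: contraNneq nq' => l'0; rewrite q'E l'0 scale0r.
by exists (l / l'); rewrite q'E scalerA divfK.
Qed.

Lemma tri_diff_uniq p q P P' : p != 0 -> q != 0 -> f p = 0 -> f q = 0 ->
  P' != 0 -> T p P q -> T p P' q -> exists l, P = l *: P'.
Proof.
move=> np nq fp fq nP' /tri_eqn_diffP e /tri_eqn_diffP e'.
have [i hi si] := tri_diff_neq0 np nq fp fq.
have [l ->] := cross_eq0 (cross_perp (e i) (e i.+1)) si.
have [l' P'E] := cross_eq0 (cross_perp (e' i) (e' i.+1)) si.
have nl' : l' != 0.
  by apply: contraNneq nP' => l'0; rewrite P'E l'0 scale0r.
by exists (l / l'); rewrite P'E scalerA divfK.
Qed.

Lemma tri_diff_ex p q : p != 0 -> q != 0 -> f p = 0 -> f q = 0 ->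
  exists P, [/\ P != 0, g P = 0 & T p P q].
Proof.
move=> np nq fp fq; have [i hi si] := tri_diff_neq0 np nq fp fq.
exists (tri_diff A B D p q i); split=> //; first exact: tri_diff_on.
exact: tri_diff_tri.
Qed.

End Coefficients.

Lemma tri_assoc A B D p P q Q R r : A != 0 -> B != 0 -> D != 0 ->
  3 != 0 :> L -> P != 0 -> q != 0 -> Q != 0 ->
  diag_cubic 1 1 (A * B * D) P = 0 -> diag_cubic A B D q = 0 ->
  diag_cubic 1 1 (A * B * D) Q = 0 ->
  tri A B D p P q -> tri A B D q Q r -> tri 1 1 (A * B * D) P Q R ->
  tri A B D p R r.
Proof.
move=> nA nB nD n3 nP nq nQ gP fq gQ /tri_sym pPq qQr PQR.
have nP' : swap12 P != 0.
  apply: contraNneq nP => /rowP e; apply/eqP; apply: row3P; rewrite !mxE.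
  have := e 0; have := e 1; have := e 2.
  by rewrite /swap12 !row3E !mxE => -> -> ->.
have gP' := etrans (diag_cubic_swap12 _ _) gP.
have nABD : A * B * D != 0 by rewrite !mulf_neq0.
(* [tri_sym] has turned p + P = q into q - P = p, so that p too is a multiple of an explicit
   solution computed from q. *)
have [i [l [hi ->]]] := tri_kernel nA nB nD n3 nq nP' fq gP' pPq.
have [j [m [hj ->]]] := tri_kernel nA nB nD n3 nq nQ fq gQ qQr.
have gQ1 : diag_cubic 1 1 (1 * 1 * (A * B * D)) Q = 0 by rewrite !mul1r.
have [h [n [hh ->]]] :=
  tri_kernel (oner_neq0 _) (oner_neq0 _) nABD n3 nP nQ gP gQ1 PQR.
by apply: triZ; apply: tri_assoc_sol.
Qed.

End TriField.

(** * Coordinate vectors of projective points *)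

Section ProjectivePoints.
Variable L : fieldType.
Implicit Types (v : 'rV[L]_3) (P Q : P2 L).

Lemma pivotZ l v : pivot (l *: v) = l * pivot v.
Proof.
rewrite /pivot !mxE; have [->|nl] := eqVneq l 0; first by rewrite !mul0r eqxx.
by rewrite !mulf_eq0 (negPf nl) /=; do 2 case: ifP => // _.
Qed.

Lemma pivot_neq0 v : v != 0 -> pivot v != 0.
Proof.
rewrite /pivot; case: ifPn => // /negPn/eqP z0; case: ifPn => // /negPn/eqP y0.
apply: contraNneq => x0; apply/eqP; apply: row3P.
by rewrite !mxE x0 y0 z0.
Qed.

Lemma P2_neq0 P : val P != 0.
Proof.
apply: contraTneq (valP P) => ->.
by rewrite /pivot !mxE eqxx eq_sym oner_neq0.
Qed.

(** Both representatives have pivot 1, which forces the scalar to be 1. *)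
Lemma P2_eqZ l P Q : val P = l *: val Q -> P = Q.
Proof.
move=> e; apply: val_inj; move: (congr1 (@pivot L) e).
rewrite pivotZ (eqP (valP P)) (eqP (valP Q)) mulr1 => l1.
by rewrite e -l1 scale1r.
Qed.

Lemma val_proj v : v != 0 -> exists2 l, l != 0 & val (proj v) = l *: v.
Proof.
move=> nv; exists (pivot v)^-1; first by rewrite invr_eq0 pivot_neq0.
by rewrite /proj val_insubd pivotZ mulVf ?pivot_neq0 ?eqxx.
Qed.

Lemma affpt_val (x y : L) : val (affpt x y) = row3 x y 1.
Proof.
by rewrite -[row3 x y 1]/(vec3 x y 1) [LHS]vec3_eta -/(pX _) -/(pY _) -/(pZ _)
  !affptE.
Qed.

Lemma pt0_val : val (pt0 L) = row3 0 1 0.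
Proof. by []. Qed.

End ProjectivePoints.

(** * Flex coordinates on E and the chord-and-tangent law *)

Section WeierstrassCoordinates.

(** The parameter [s] is a sign, and [s = -1] precomposes the coordinates with inversion on E. The
    curve is y^2 = x^3 - 27 d^2 in the old coordinates and U^3 + V^3 = 2d W^3 in the new ones. *)
Definition flex_coord (R : comNzRingType) (d s : R) (v : 'rV[R]_3) :=
  row3 (9 * d * v 0 2 + s * v 0 1) (9 * d * v 0 2 - s * v 0 1) (3 * v 0 0).

Lemma flex_coordZ (R : comNzRingType) (d s l : R) v :
  flex_coord d s (l *: v) = l *: flex_coord d s v.
Proof. by apply: row3P; rewrite /flex_coord !mxE /=; split; ring. Qed.

Lemma flex_coord_cubic (R : comNzRingType) (d s : R) v : s ^+ 2 = 1 ->
  diag_cubic 1 1 (- (2 * d)) (flex_coord d s v) =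
  54 * d * (v 0 1 ^+ 2 * v 0 2 - (v 0 0 ^+ 3 - 27 * d ^+ 2 * v 0 2 ^+ 3)).
Proof. by move=> es; rewrite /diag_cubic /flex_coord !row3E; ring: es. Qed.

Variable L : fieldType.
Variables d s : L.
Hypotheses (n2 : 2 != 0 :> L) (n3 : 3 != 0 :> L).
Hypotheses (nd : d != 0) (es : s ^+ 2 = 1).
Implicit Types v : 'rV[L]_3.

Let ns : s != 0.
Proof. by rewrite -sqrf_eq0 es oner_neq0. Qed.

Let n18 : 18 != 0 :> L.
Proof.
by rewrite (_ : 18 = 2 * 3 ^+ 2); [rewrite mulf_neq0 ?expf_neq0 | ring].
Qed.

Lemma flex_coord_surj v : exists w, v = flex_coord d s w.
Proof.
exists (row3 (v 0 2 / 3) ((v 0 0 - v 0 1) / (2 * s))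
  ((v 0 0 + v 0 1) / (18 * d))).
apply: row3P; rewrite /flex_coord !row3E; split; field; rewrite ?n3 //.
- by rewrite ns nd n2 n18.
- by rewrite ns nd n2 n18.
Qed.

Lemma flex_coord_inj : injective (flex_coord d s).
Proof.
move=> v w /rowP e; have := e 0; have := e 1; have := e 2.
rewrite /flex_coord !row3E => /(mulfI n3) e0 ey ex.
have [ez' ey'] : 18 * d * (v 0 2 - w 0 2) = 0 /\ 2 * s * (v 0 1 - w 0 1) = 0.
  split.
    transitivity ((9 * d * v 0 2 + s * v 0 1) + (9 * d * v 0 2 - s * v 0 1)
      - ((9 * d * w 0 2 + s * w 0 1) + (9 * d * w 0 2 - s * w 0 1))).
      by ring.
    by rewrite ex ey subrr.
  transitivity ((9 * d * v 0 2 + s * v 0 1) - (9 * d * v 0 2 - s * v 0 1)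
    - ((9 * d * w 0 2 + s * w 0 1) - (9 * d * w 0 2 - s * w 0 1))).
    by ring.
  by rewrite ex ey subrr.
apply: row3P; split=> //; apply/eqP; rewrite -subr_eq0; apply/eqP.
  by apply: (mulfI (mulf_neq0 n2 ns)); rewrite ey' mulr0.
by apply: (mulfI (mulf_neq0 n18 nd)); rewrite ez' mulr0.
Qed.

Lemma flex_coord_neq0 v : v != 0 -> flex_coord d s v != 0.
Proof.
apply: contraNneq => e; apply/eqP; apply: flex_coord_inj; rewrite e.
by rewrite -[X in flex_coord _ _ X](scale0r 0) flex_coordZ scale0r.
Qed.

(** The hypothesis relating [l], [x1], [x2] is the difference of the two curve equations divided by
    x2 - x1, with y2 eliminated through the slope. *)
Let chord_tri x1 y1 x2 y2 l : y1 ^+ 2 = x1 ^+ 3 - 27 * d ^+ 2 ->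
  l ^+ 2 * (x2 - x1) + 2 * l * y1 = x1 ^+ 2 + x1 * x2 + x2 ^+ 2 ->
  y2 = y1 + l * (x2 - x1) ->
  let x3 := l ^+ 2 - x1 - x2 in
  tri 1 1 (- (2 * d)) (flex_coord d s (row3 x1 y1 1))
    (flex_coord d s (row3 x2 y2 1))
    (flex_coord d s (row3 x3 (l * (x1 - x3) - y1) 1)).
Proof.
move=> e1 h -> /=; rewrite /flex_coord !row3E tri_row3.
have {}h : x2 ^+ 2 = l ^+ 2 * (x2 - x1) + 2 * l * y1 - x1 ^+ 2 - x1 * x2.
  by rewrite h; ring.
by split; ring: es e1 h.
Qed.

Let tangent_tri x y l : 2 * y != 0 -> y ^+ 2 = x ^+ 3 - 27 * d ^+ 2 ->
  l = 3 * x ^+ 2 / (2 * y) -> let x3 := l ^+ 2 - x - x in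
  tri 1 1 (- (2 * d)) (flex_coord d s (row3 x y 1))
    (flex_coord d s (row3 x y 1))
    (flex_coord d s (row3 x3 (l * (x - x3) - y) 1)).
Proof.
rewrite mulf_eq0 => /norP[_ ny] e -> /=; rewrite /flex_coord !row3E tri_row3.
by split; field: es e; rewrite ny n2.
Qed.

(** This links the relations to the group law of E, by one identity for each branch of [add_pt]. *)
Lemma add_pt_tri (k : fieldType) (j : {rmorphism k -> L}) c (P Q : EC c j) :
  j c = - (27 * d ^+ 2) ->
  tri 1 1 (- (2 * d)) (flex_coord d s (val (val P)))
    (flex_coord d s (val (val Q))) (flex_coord d s (val (val (ec_add P Q)))).
Proof.
case: P Q => [P hP] [Q hQ] jc /=; rewrite /add_pt.
case: ifPn => [/eqP->|nP].
  by rewrite pt0_val /tri /flex_coord !row3E; split; ring.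
case: ifPn => [/eqP->|nQ].
  by rewrite pt0_val /tri /flex_coord !row3E; split; ring.
have [x1 [y1 [-> e1]]] := on_weierstrassP hP nP.
have [x2 [y2 [-> e2]]] := on_weierstrassP hQ nQ.
move: e1 e2; rewrite jc !affptE => e1 e2.
case: ifPn => [nx|/negPn/eqP ex].
  have nx12 : x2 - x1 != 0 by rewrite subr_eq0 eq_sym.
  rewrite !affpt_val; apply: chord_tri => //;
    last by rewrite divfK // addrC subrK.
  apply: (mulIf nx12); set l := _ / _.
  have y2E : y2 = y1 + l * (x2 - x1) by rewrite divfK // addrC subrK.
  transitivity (y2 ^+ 2 - y1 ^+ 2); first by rewrite y2E; ring.
  by rewrite e1 e2; ring.
subst x2; case: ifPn => [/eqP ->|ny].
  rewrite !affpt_val pt0_val /flex_coord !row3E tri_row3.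
  by split; ring.
have yy : y2 = y1.
  have : (y1 - y2) * (y1 + y2) == 0 by rewrite -subr_sqr e1 e2 subrr.
  by rewrite mulf_eq0 subr_eq0 addr_eq0 (negPf ny) orbF => /eqP.
subst y2; rewrite !affpt_val; apply: tangent_tri => //.
by rewrite mulr_natl mulr2n addr_eq0.
Qed.

End WeierstrassCoordinates.

(** * Bihomogeneous polynomials in two triples of variables *)

Section Bihomogeneous.
Variable k : fieldType.
Implicit Types (p q : {mpoly k[3 + 3]}) (m : 'X_{1..3 + 3}).

Lemma bihomogP d e p :
  reflect (forall m, m \in msupp p -> (\sum_(i < 3) m (lshift 3 i))%N = d /\
    (\sum_(i < 3) m (rshift 3 i))%N = e) (bihomog d e p).
Proof.
apply: (iffP allP) => h m /h; first by case/andP => /eqP-> /eqP->.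
by case=> -> ->; rewrite !eqxx.
Qed.

Lemma bihomogM d e d' e' p q : bihomog d e p -> bihomog d' e' q ->
  bihomog (d + d') (e + e') (p * q).
Proof.
move=> /bihomogP hp /bihomogP hq; apply/bihomogP => m /msuppM_le.
case/allpairsP => -[m1 m2] /= [/hp[<- <-] /hq[<- <-] ->].
by split; rewrite -big_split; apply: eq_bigr => i _; rewrite mnmDE.
Qed.

Lemma bihomogD d e p q :
  bihomog d e p -> bihomog d e q -> bihomog d e (p + q).
Proof.
move=> /bihomogP hp /bihomogP hq; apply/bihomogP => m /msuppD_le.
by rewrite mem_cat => /orP[/hp|/hq].
Qed.

Lemma bihomogN d e p : bihomog d e p -> bihomog d e (- p).
Proof.
move=> /bihomogP hp; apply/bihomogP => m.
by rewrite (perm_mem (msuppN p)) => /hp.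
Qed.

Lemma bihomogC c : bihomog 0 0 (c%:MP : {mpoly k[3 + 3]}).
Proof.
apply/bihomogP => m; rewrite msuppC; case: eqP => // _; rewrite inE => /eqP->.
by split; apply: big1 => i _; rewrite mnm0E.
Qed.

Lemma bihomog_lshift i : bihomog 1 0 ('X_(lshift 3 i) : {mpoly k[3 + 3]}).
Proof.
apply/bihomogP => m; rewrite msuppX inE => /eqP->; split.
  rewrite (bigD1 i) //= big1 ?mnm1E ?eqxx // => l nl.
  by rewrite mnm1E (inj_eq (@lshift_inj _ _)) eq_sym (negPf nl).
by apply: big1 => l _; rewrite mnm1E eq_lrshift.
Qed.

Lemma bihomog_rshift i : bihomog 0 1 ('X_(rshift 3 i) : {mpoly k[3 + 3]}).
Proof.
apply/bihomogP => m; rewrite msuppX inE => /eqP->; split.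
  by apply: big1 => l _; rewrite mnm1E eq_rlshift.
rewrite (bigD1 i) //= big1 ?mnm1E ?eqxx // => l nl.
by rewrite mnm1E (inj_eq (@rshift_inj _ _)) eq_sym (negPf nl).
Qed.

End Bihomogeneous.

(** * Compatibility with ring morphisms, for evaluation and for Galois conjugation *)

Lemma map_tri (R S : comNzRingType) (f : {rmorphism R -> S}) A B D p q r :
  tri A B D p q r ->
  tri (f A) (f B) (f D) (map_mx f p) (map_mx f q) (map_mx f r).
Proof.
by case=> e0 e1 e2; split; rewrite !mxE -!(rmorphM, rmorphD) /=
  ?e0 ?e1 ?e2 rmorph0.
Qed.

Lemma map_tri_sol (R S : comNzRingType) (f : {rmorphism R -> S}) A B D p P i :
  map_mx f (tri_sol A B D p P i) =
  tri_sol (f A) (f B) (f D) (map_mx f p) (map_mx f P) i.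
Proof.
by case: i => [|[|[|i]]]; apply: row3P; rewrite /tri_sol /tri_eqn /cross /=
  !(row3E, mxE) /= !(rmorphB, rmorphM) /=; split.
Qed.

Lemma map_flex_coord (R S : comNzRingType) (f : {rmorphism R -> S}) e s v :
  map_mx f (flex_coord e s v) = flex_coord (f e) (f s) (map_mx f v).
Proof.
by apply: row3P; rewrite /flex_coord !(row3E, mxE) /=
  !(rmorph_nat, rmorphB, rmorphD, rmorphM); split.
Qed.

(** * The action of E on C *)

Section Action.
Variables (k : fieldType) (a b sg : k).
Hypotheses (h2 : 2%N \notin [pchar k]) (h3 : 3%N \notin [pchar k]).
Hypotheses (ha : a != 0) (hb : b != 0) (hsg : sg ^+ 2 = 1).

Let d : k := a * b / 2.

(* The parameter [sg] = 1 or -1 composes the action with a power of the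
   inversion of E, so that both signs of a class are covered. *)
Definition translation_law (i : nat) : 'rV[{mpoly k[3 + 3]}]_3 :=
  tri_sol a%:MP b%:MP (- 1) (\row_l 'X_(lshift 3 l))
    (flex_coord d%:MP sg%:MP (\row_l 'X_(rshift 3 l))) i.

(** By [tri_sol_neq0], at every point of C x E at least one of these three formulas is nonzero. *)
Definition translation : bimap k := [seq translation_law i | i <- iota 0 3].

(** The equations in q have coefficients of bidegree (1, 1), and a cross product multiplies two of
    them. *)
Lemma translation_law_bihomog i l : bihomog 2 2 (translation_law i 0 l).
Proof.
pose X l : {mpoly k[3 + 3]} := (\row_l 'X_(lshift 3 l) : 'rV_3) 0 l.
pose Y l : {mpoly k[3 + 3]} :=
  flex_coord d%:MP sg%:MP (\row_l 'X_(rshift 3 l)) 0 l.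
have hX m : bihomog 1 0 (X m) by rewrite /X mxE bihomog_lshift.
have hY m : bihomog 0 1 (Y m).
  have c1 c x : bihomog 0 1 (c%:MP * 'X_(rshift 3 x) : {mpoly k[3 + 3]}).
    exact: (bihomogM (bihomogC _) (bihomog_rshift _ _)).
  have c2 c e x :
      bihomog 0 1 (c%:MP * e%:MP * 'X_(rshift 3 x) : {mpoly k[3 + 3]}).
    by rewrite -mulrA; apply: (bihomogM (bihomogC _) (c1 _ _)).
  (* The numerals 9 and 3 become constant polynomials, to which [bihomogC] applies. *)
  rewrite /Y /flex_coord mxE -!mpolyC_nat.
  case: m => [[|[|[|//]]] Hm] /=; rewrite !mxE //.
    by apply: bihomogD.
  by apply: bihomogD => //; apply: bihomogN.
have hE c x y : bihomog 1 1 (c%:MP * Y x * X y).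
  exact: (bihomogM (bihomogM (bihomogC _) (hY _)) (hX _)).
have hF x y : bihomog 1 1 (Y x * X y) by exact: (bihomogM (hY _) (hX _)).
have hG i' m : bihomog 1 1 (tri_eqn a%:MP b%:MP (- 1) (\row_l 'X_(lshift 3 l))
    (flex_coord d%:MP sg%:MP (\row_l 'X_(rshift 3 l))) i' 0 m).
  rewrite /tri_eqn -mpolyC1 -mpolyCN.
  by case: i' => [|[|[|i']]]; rewrite mxE; case: m => [[|[|[|//]]] Hm] /=;
    first [apply: hE | apply: hF].
rewrite /translation_law /tri_sol; move: (hG i) (hG i.+1).
move: (tri_eqn _ _ _ _ _ i) (tri_eqn _ _ _ _ _ i.+1) => u v hu hv.
rewrite /cross mxE; case: l => [[|[|[|//]]] Hl] /=; apply: bihomogD;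
  rewrite -?mulNr; first [exact: (bihomogM (hu _) (hv _))
    | exact: (bihomogM (bihomogN (hu _)) (hv _))].
Qed.

Section Points.
Variables (L : fieldType) (j : {rmorphism k -> L}).
Implicit Types (p q P Q : P2 L).

Let nat_neq0 (n : nat) : prime n -> n \notin [pchar k] -> n%:R != 0 :> L.
Proof. by move=> pn; rewrite inE /= pn /= -(rmorph_nat j) fmorph_eq0. Qed.

Let n2 : 2 != 0 :> L. Proof. exact: nat_neq0. Qed.
Let n3 : 3 != 0 :> L. Proof. exact: nat_neq0. Qed.
Let nA : j a != 0. Proof. by rewrite fmorph_eq0. Qed.
Let nB : j b != 0. Proof. by rewrite fmorph_eq0. Qed.
Let nD : -1 != 0 :> L. Proof. by rewrite oppr_eq0 oner_neq0. Qed.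
Let k2 : 2 != 0 :> k. Proof. by rewrite -(fmorph_eq0 j) rmorph_nat. Qed.
Let nd : j d != 0.
Proof. by rewrite fmorph_eq0 !mulf_neq0 ?invr_eq0. Qed.
Let es : j sg ^+ 2 = 1. Proof. by rewrite -rmorphXn /= hsg rmorph1. Qed.
Let ABD : j a * j b * -1 = - (2 * j d).
Proof.
transitivity (j (a * b * -1)); first by rewrite !rmorphM rmorphN1.
rewrite -(rmorph_nat j) -rmorphM -rmorphN; congr (j _); rewrite /d; field.
exact: k2.
Qed.
Let jcE : j (jac_coef a b) = - (27 * j d ^+ 2).
Proof.
rewrite -(rmorph_nat j) -rmorphXn -rmorphM -rmorphN; congr (j _).
by rewrite /jac_coef /d; field; rewrite k2 (_ : 4 = 2 * 2) ?mulf_neq0 //; ring.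
Qed.

Let F := diag_cubic (j a) (j b) (- 1).
Let G := diag_cubic 1 1 (j a * j b * -1).
Let T := tri (j a) (j b) (- 1).
Let W := flex_coord (j d) (j sg).

Lemma on_cubicC p : on_curve j (cubicC a b) p = (F (val p) == 0).
Proof.
rewrite /on_curve /cubicC !rmorphB /= !mmapZ !rmorphXn /= !mmapX !mmap1U /F.
rewrite /diag_cubic -oppr_eq0; congr (_ == 0); ring.
Qed.

Lemma on_weierstrass_flex P :
  on_curve j (weierstrass (jac_coef a b)) P = (G (W (val P)) == 0).
Proof.
rewrite on_weierstrassE /G ABD flex_coord_cubic // -subr_eq0 jcE.
have n54 : 54 * j d != 0.
  by rewrite mulf_neq0 // (_ : 54 = 2 * 3 ^+ 3);
    [rewrite mulf_neq0 ?expf_neq0 | ring].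
by rewrite mulf_eq0 (negPf n54) /pX /pY /pZ mulNr.
Qed.

Lemma bieval_translation p P i :
  bieval j (translation_law i) p P =
  tri_sol (j a) (j b) (- 1) (val p) (W (val P)) i.
Proof.
pose h (l : 'I_(3 + 3)) := row_mx (val p) (val P) 0 l.
transitivity (map_mx (mmap j h) (translation_law i)).
  by apply/rowP => l; rewrite !mxE.
rewrite /translation_law map_tri_sol map_flex_coord rmorphN1 /= !mmapC.
congr tri_sol; last congr flex_coord; apply/rowP => l;
  by rewrite !mxE mmapX mmap1U /h ?row_mxEl ?row_mxEr.
Qed.

Lemma translation_tri p P : on_curve j (cubicC a b) p ->
  on_curve j (weierstrass (jac_coef a b)) P ->
  [/\ T (val p) (W (val P)) (val (biapp j translation p P)),
      on_curve j (cubicC a b) (biapp j translation p P)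
    & exists2 phi, phi \in translation & bieval j phi p P != 0].
Proof.
rewrite !on_cubicC on_weierstrass_flex => /eqP fp /eqP gP.
have nP : W (val P) != 0 by apply: flex_coord_neq0 => //; exact: P2_neq0.
have [i hi ni] := tri_sol_neq0 nA nB nD n3 (P2_neq0 p) nP fp gP.
have hex : exists2 phi, phi \in translation & bieval j phi p P != 0.
  exists (translation_law i); last by rewrite bieval_translation.
  by apply: map_f; rewrite mem_iota.
rewrite /biapp; set vs := [seq _ <- _ | _].
(* The list of nonzero values is nonempty, so its head is a genuine value and not the default 0. *)
have : head 0 vs \in vs.
  have [phi hphi nphi] := hex.
  have : bieval j phi p P \in vs.
    by rewrite mem_filter nphi; apply: (map_f (fun phi => bieval j phi p P)).
  by case: (vs) => // v vs' _; rewrite mem_head.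
rewrite mem_filter => /andP[nv /mapP[phi /mapP[l _ ->] vE]].
have [c nc ->] := val_proj nv; rewrite vE bieval_translation.
have [hT hF] := tri_sol_on l fp gP.
split=> //; first exact: triZr.
rewrite -/F in hF; apply/eqP; rewrite -(mulr0 (c ^+ 3)) -hF /F /diag_cubic !mxE.
by ring.
Qed.

(** The relations determine q up to a scalar, so checking them identifies q as p + P. All later
    computations of the action use this criterion. *)
Lemma translation_eq p P q : on_curve j (cubicC a b) p ->
  on_curve j (weierstrass (jac_coef a b)) P ->
  T (val p) (W (val P)) (val q) -> biapp j translation p P = q.
Proof.
move=> hp hP hT; have [hT' _ _] := translation_tri hp hP.
move: hp hP; rewrite on_cubicC on_weierstrass_flex => /eqP fp /eqP gP.
have nP : W (val P) != 0 by apply: flex_coord_neq0 => //; exact: P2_neq0.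
have [l /P2_eqZ->//] :=
  tri_uniq nA nB nD n3 (P2_neq0 p) nP fp gP (P2_neq0 q) hT' hT.
Qed.

Lemma translation0 p : on_curve j (cubicC a b) p ->
  biapp j translation p (val (ec0 (jac_coef a b) j)) = p.
Proof.
move=> hp; apply: translation_eq => //; first exact: on_weierstrass0.
rewrite /T /W [val (val _)](_ : _ = row3 0 1 0) // /tri /flex_coord !row3E.
by split; ring.
Qed.

Lemma translationD p (P Q : EC (jac_coef a b) j) : on_curve j (cubicC a b) p ->
  biapp j translation (biapp j translation p (val P)) (val Q) =
  biapp j translation p (val (ec_add P Q)).
Proof.
move=> hp; have [pP hpP _] := translation_tri hp (valP P).
have [pPQ _ _] := translation_tri hpP (valP Q).
apply/esym/(translation_eq hp (valP (ec_add P Q))).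
have W0 (R : EC (jac_coef a b) j) :
    W (val (val R)) != 0 /\ G (W (val (val R))) = 0.
  split; first by apply: flex_coord_neq0 => //; exact: P2_neq0.
  by apply/eqP; rewrite -on_weierstrass_flex (valP R).
have [[nP gP] [nQ gQ]] := (W0 P, W0 Q).
move: hpP; rewrite on_cubicC => /eqP fpP.
(* The middle point is p + P; the group law enters only through the relations for P, Q and P + Q. *)
apply: (tri_assoc nA nB nD n3 nP (P2_neq0 _) nQ gP fpP gQ pP pPQ).
by rewrite ABD; apply: add_pt_tri.
Qed.

(** The relations are linear in P and of rank 2, so the difference q - p exists and is unique over
    any field [L] containing the coordinates of p and q. *)
Lemma translation_simply_transitive p q :
  on_curve j (cubicC a b) p -> on_curve j (cubicC a b) q ->
  exists! P : EC (jac_coef a b) j, biapp j translation p (val P) = q.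
Proof.
move=> hp hq; have := hp; have := hq; rewrite !on_cubicC => /eqP fq /eqP fp.
have [np nq] := (P2_neq0 p, P2_neq0 q).
have [v [nv gv pvq]] := tri_diff_ex nA nB nD n3 np nq fp fq.
have [w vE] := flex_coord_surj n2 n3 nd es v.
have nw : w != 0.
  by apply: contraNneq nv => w0; rewrite vE w0
    -[X in flex_coord _ _ X](scale0r 0) flex_coordZ scale0r.
have [c nc cE] := val_proj nw.
have WE : W (val (proj w)) = c *: v by rewrite cE /W flex_coordZ -vE.
have hw : on_curve j (weierstrass (jac_coef a b)) (proj w).
  rewrite on_weierstrass_flex WE -[X in _ == X](mulr0 (c ^+ 3)) -gv.
  by rewrite /G /diag_cubic !mxE; apply/eqP; ring.
have pwq : T (val p) (W (val (proj w))) (val q).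
  by rewrite WE; apply: triZm.
exists (exist _ (proj w) hw); split; first exact: translation_eq.
move=> [Q hQ] /= pQ; apply: val_inj => /=.
have [pQq _ _] := translation_tri hp hQ; rewrite pQ in pQq.
have nWQ : W (val Q) != 0 by apply: flex_coord_neq0 => //; exact: P2_neq0.
have [l] := tri_diff_uniq nA nB nD n3 np nq fp fq nWQ pwq pQq.
by rewrite -[l *: _]flex_coordZ => /(flex_coord_inj n2 n3 nd es)/P2_eqZ.
Qed.

End Points.

(** Each partial derivative is a nonzero constant times the square of one coordinate, and the
    coordinates of a point do not all vanish. *)
Lemma cubicC_smooth : smooth_plane_curve (cubicC a b).
Proof.
split; first exists 3%N => //.
  have X3 l : ('X_l ^+ 3 : {mpoly k[3]}) \is 3.-homog.
    by rewrite -[3%N]/(1 * 3)%N dhomogMn // dhomogX /= mdeg1.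
  by rewrite /cubicC !rpredB ?dhomogZ.
move=> L j P _.
have nat_neq0 (n : nat) : prime n -> n \notin [pchar k] -> n%:R != 0 :> L.
  by move=> pn; rewrite inE /= pn /= -(rmorph_nat j) fmorph_eq0.
have n3 := nat_neq0 3%N isT h3.
apply/existsP; apply: contraT; rewrite negb_exists => /forallP e.
case/negP: (P2_neq0 P); apply/eqP; apply: row3P; rewrite !mxE.
have dX i l : ('X_l : {mpoly k[3]})^`M(i) = (l == i)%:R.
  rewrite mderivX mnm1E; case: eqVneq => [->|_]; last by rewrite scale0r.
  rewrite (_ : (_ - _)%MM = 0%MM) ?mpolyX0 ?scale1r //.
  by apply/mnmP => x; rewrite mnmBE mnm0E subnn.
have dX3 i l : mmap j (fun i => val P 0 i) ('X_l ^+ 3 : {mpoly k[3]})^`M(i) =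
    (l == i)%:R * 3 * val P 0 l ^+ 2.
  rewrite !exprS expr0 mulr1 !mderivM dX !(rmorphD, rmorphM) /= rmorph_nat.
  by rewrite mmapX mmap1U; ring.
have D i : mmap j (fun i => val P 0 i) (cubicC a b)^`M(i) =
    3 * ((2 == i)%:R * val P 0 2 ^+ 2 - j a * (0 == i)%:R * val P 0 0 ^+ 2
    - j b * (1 == i)%:R * val P 0 1 ^+ 2).
  by rewrite /cubicC !mderivB !mderivZ !rmorphB /= !mmapZ !dX3; ring.
have {}e (i : 'I_3) : (2 == i)%:R * val P 0 2 ^+ 2
    - j a * (0 == i)%:R * val P 0 0 ^+ 2
    - j b * (1 == i)%:R * val P 0 1 ^+ 2 = 0.
  apply: (mulfI n3); rewrite mulr0 -D; apply/eqP.
  by move: (e i); rewrite negbK.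
have sq0 (c x : L) : c != 0 -> c * x ^+ 2 = 0 -> x = 0.
  by move=> nc /eqP; rewrite mulf_eq0 (negPf nc) expf_eq0 => /eqP.
split; [apply: (sq0 (- j a)) | apply: (sq0 (- j b)) | apply: (sq0 1)];
  rewrite ?oppr_eq0 ?fmorph_eq0 ?oner_neq0 //.
- by rewrite -[RHS](e 0) /=; ring.
- by rewrite -[RHS](e 1) /=; ring.
- by rewrite -[RHS](e 2) /=; ring.
Qed.

Lemma translation_is_phs : is_phs (jac_coef a b) (cubicC a b) translation.
Proof.
split; first exact: cubicC_smooth.
- split=> [phi /mapP[i _ ->]|L j p P hp hP].
    by exists 2%N, 2%N => l; exact: translation_law_bihomog.
  have [_ h hex] := translation_tri hp hP; split=> // phi /mapP[i _ ->] ni.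
  (* Different formulas agree where they are nonzero, because each value satisfies the relations. *)
  apply/esym/translation_eq => //; have [c nc ->] := val_proj ni.
  move: hp hP; rewrite bieval_translation on_cubicC on_weierstrass_flex.
  move=> /eqP fp /eqP gP; have [hT _] := tri_sol_on i fp gP.
  exact: triZr.
- exact: translation0.
- exact: translationD.
- exact: translation_simply_transitive.
Qed.

End Action.

(** * Elementary properties of the group law *)

Section EllipticCurveLaw.
Variables (k : fieldType) (c : k) (L : fieldType) (j : {rmorphism k -> L}).
Implicit Types P Q : EC c j.

Lemma ec_addr0 P : ec_add P (ec0 c j) = P.
Proof.
by apply: val_inj; rewrite /= /add_pt eqxx; case: ifP => // /eqP ->.
Qed.

Lemma ec_addrN P : ec_add P (ec_neg P) = ec0 c j.
Proof.
apply: val_inj; case: P => P hP; rewrite /= /neg_pt.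
case: eqVneq => [->|nP]; first by rewrite /add_pt eqxx.
have [x [y [-> _]]] := on_weierstrassP hP nP.
by rewrite /add_pt !affptE !(negPf (affpt_neq0 _ _)) !eqxx opprK eqxx.
Qed.

Lemma ec_addC P Q : ec_add P Q = ec_add Q P.
Proof.
apply: val_inj; case: P Q => [P hP] [Q hQ]; rewrite /= /add_pt.
case: ifPn => [/eqP->|nP]; first by case: ifPn => [/eqP|].
case: ifPn => // nQ.
have [x1 [y1 [-> e1]]] := on_weierstrassP hP nP.
have [x2 [y2 [-> e2]]] := on_weierstrassP hQ nQ.
rewrite !affptE [x2 == x1]eq_sym; case: ifPn => [nx|/negPn/eqP ex].
  have d12 : x2 - x1 != 0 by rewrite subr_eq0 eq_sym.
  have lE : (y1 - y2) / (x1 - x2) = (y2 - y1) / (x2 - x1).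
    by rewrite -opprB -[x1 - x2]opprB invrN mulrNN.
  rewrite {}lE; set l := (y2 - y1) / (x2 - x1).
  have : y2 = y1 + l * (x2 - x1) by rewrite divfK // addrC subrK.
  by move: l => l ->; apply: (congr2 (@affpt L)); ring.
subst x2; rewrite [y2 == - y1]eq_sym eqr_oppLR; case: ifPn => // ny.
have : (y1 - y2) * (y1 + y2) == 0 by rewrite -subr_sqr e1 e2 subrr.
rewrite mulf_eq0 subr_eq0 addr_eq0 => /orP[/eqP-> //|/eqP e].
by rewrite e eqxx in ny.
Qed.

End EllipticCurveLaw.

(** * Galois equivariance and the cohomology class of C *)

Section Twist.
Variables (k : fieldType) (a b sg : k).
Hypotheses (h2 : 2%N \notin [pchar k]) (h3 : 3%N \notin [pchar k]).
Hypotheses (ha : a != 0) (hb : b != 0) (hsg : sg ^+ 2 = 1).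
Variables (ks : fieldType) (iota : {rmorphism k -> ks}).
Local Notation c := (jac_coef a b).
Local Notation mu := (translation a b sg).
Local Notation E := (EC c iota).
Local Notation act p P := (biapp iota mu p (val (P : E))).
Implicit Types (p : P2 ks) (P Q R : E).

Let act_phs := translation_is_phs h2 h3 ha hb hsg.

Let act_on p P :
  on_curve iota (cubicC a b) p -> on_curve iota (cubicC a b) (act p P).
Proof. by move=> hp; case: (translation_tri h2 h3 ha hb hsg hp (valP P)). Qed.

Let actI p P Q : on_curve iota (cubicC a b) p -> act p P = act p Q -> P = Q.
Proof.
move=> hp e; have [R [_ uR]] := phs_simply_transitive act_phs hp (act_on P hp).
by rewrite -(uR P erefl) -(uR Q (esym e)).
Qed.

(* The associativity of the chord-and-tangent law, needed below only over ks,
   comes for free from the action. *)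
Lemma ec_addA_of_torsor p P Q R : on_curve iota (cubicC a b) p ->
  ec_add P (ec_add Q R) = ec_add (ec_add P Q) R.
Proof.
move=> hp; apply: (actI hp); have hpP := act_on P hp.
by rewrite -!(phs_actD act_phs).
Qed.

Lemma on_cubicC_gal (s : Defs.Gal iota) p :
  on_curve iota (cubicC a b) p -> on_curve iota (cubicC a b) (gal_pt s p).
Proof.
rewrite !on_cubicC /diag_cubic /= !mxE => /eqP e; apply/eqP.
rewrite -(gal_fix s a) -(gal_fix s b) -(rmorphN1 s).
by rewrite -!(rmorphXn, rmorphM, rmorphD) /= e rmorph0.
Qed.

(** The relations have coefficients in k, so conjugation by s preserves them. *)
Lemma gal_translation (s : Defs.Gal iota) p P : on_curve iota (cubicC a b) p ->
  gal_pt s (act p P) = act (gal_pt s p) (gal_ec s P).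
Proof.
move=> hp; apply/esym/(translation_eq h2 h3 ha hb hsg).
- exact: on_cubicC_gal.
- exact: (valP (gal_ec s P)).
have [/(map_tri s) hT _ _] := translation_tri h2 h3 ha hb hsg hp (valP P).
by move: hT; rewrite map_flex_coord rmorphN1 !gal_fix.
Qed.

Lemma gal_affpt (s : Defs.Gal iota) x y :
  gal_pt s (affpt x y) = affpt (s x) (s y).
Proof.
by apply: P2_inj; rewrite affptE /pX /pY /pZ /= mxE -/(pX _) -/(pY _) -/(pZ _)
  affptE ?rmorph1.
Qed.

Lemma gal_pt0 (s : Defs.Gal iota) : gal_pt s (pt0 ks) = pt0 ks.
Proof.
by apply: P2_inj; rewrite /pX /pY /pZ /= mxE !vec3E ?rmorph0 ?rmorph1.
Qed.

Lemma gal_ecN (s : Defs.Gal iota) P : gal_ec s (ec_neg P) = ec_neg (gal_ec s P).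
Proof.
apply: val_inj; case: P => P hP; rewrite /= /neg_pt.
case: eqVneq => [->|nP]; first by rewrite gal_pt0 eqxx.
have [x [y [-> _]]] := on_weierstrassP hP nP.
by rewrite !gal_affpt !affptE (negPf (affpt_neq0 _ _)) rmorphN.
Qed.

Variables (sqrtc : ks) (hsqrtc : sqrtc ^+ 2 = iota c).

(* The class [Psi xi] is computed on a representative of xi that may differ
   from f by the coboundary of a torsion point m; moving the base point by -m
   absorbs this coboundary. *)
Lemma phs_curve_of_Psi (f : Z1 (T3 hsqrtc)) p :
  on_curve iota (cubicC a b) p -> (forall s, act p (f s) = gal_pt s p) ->
  phs_curve_of (Psi hsqrtc (h1_class f)) (cubicC a b).
Proof.
move=> hp fp; exists mu; first exact: act_phs.
rewrite /Psi /h1_incl; set f' := h1_repr _.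
have f'E : cohomologous f = cohomologous f'.
  by rewrite /f' /h1_repr; case: constructive_indefinite_description.
(* A class is a predicate on cocycles, so this is reflexivity at [f'], with the coboundary of the
   origin. *)
have ff' : cohomologous f f'.
  rewrite f'E; exists (ec0 c iota); first exact/or3P/Or31/eqxx.
  move=> s; rewrite ec_addrN -[LHS](ec_addrN (ec0 c iota)); congr ec_add.
  by apply: val_inj; rewrite /= gal_pt0.
have [m _ fm] := ff'.
have addA P Q R := ec_addA_of_torsor P Q R hp.
exists (act p (ec_neg m)); first exact: act_on.
exists (z1_incl (@T3_sub _ _ _ _ _ hsqrtc) f') => // s.
have -> : gal_pt s (act p (ec_neg m)) =
    act p (ec_add (f s) (ec_neg (gal_ec s m))).
  rewrite (gal_translation s (ec_neg m) hp) -fp gal_ecN.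
  by rewrite (phs_actD act_phs _ _ hp).
rewrite (phs_actD act_phs _ _ hp); congr (biapp iota mu p (val _)).
(* The coboundary relation f(s) - f'(s) = s(m) - m, solved for f(s). *)
have -> : f s = ec_add (gal_ec s m) (ec_add (ec_neg m) (f' s)).
  rewrite addA -fm -addA [ec_add (ec_neg _) _]ec_addC ec_addrN.
  by rewrite ec_addr0.
by rewrite [ec_add (gal_ec s m) _]ec_addC -addA ec_addrN ec_addr0.
Qed.

End Twist.

(** * Cube roots and the cocycles in flex coordinates *)

(** The polynomial X^3 - x is separable: its derivative 3 X^2 vanishes only at 0, which is not a
    root. *)
Lemma cube_root_ex (k ks : fieldType) (iota : {rmorphism k -> ks}) (x : k) :
  3%N \notin [pchar k] -> separable_closure iota -> x != 0 ->
  exists e, e ^+ 3 = iota x.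
Proof.
move=> h3 hks nx; pose p : {poly ks} := 'X^3 - (iota x)%:P.
have sp : size p = 4%N by rewrite size_XnsubC.
have n3 : 3%:R != 0 :> ks.
  by rewrite -(rmorph_nat iota) fmorph_eq0; move: h3; rewrite inE.
have sep : separable_poly p.
  rewrite unlock derivB derivC subr0 derivXn -scaler_nat coprimepZr //.
  apply: coprimep_expr; rewrite coprimepX /root !hornerE.
  by rewrite expr0n sub0r oppr_eq0 fmorph_eq0.
have [|e] := sepcl_closed hks sep; first by rewrite sp.
by rewrite /root !hornerE subr_eq0 => /eqP e3; exists e.
Qed.

Section GammaCoordinates.
Variables (k ks : fieldType) (iota : {rmorphism k -> ks}) (c d sg sqrtD : k).
Variables (sqrtc : ks) (hsqrtc : sqrtc ^+ 2 = iota c) (omega epsilon : ks).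
Variable t : k.
Hypotheses (homega : 3.-primitive_root omega).
Hypothesis hsqrt : sqrtc = 3 * (2 * omega + 1) * iota sqrtD.
Hypotheses (heps : epsilon ^+ 3 = iota t) (hsg : sg ^+ 2 = 1).

Let omega_rel : omega ^+ 2 + omega + 1 = 0.
Proof.
have d1 : omega - 1 != 0.
  by rewrite subr_eq0 -[omega]expr1 -(prim_order_dvd homega).
apply: (mulIf d1); rewrite mul0r.
by transitivity (omega ^+ 3 - 1);
  [ring | rewrite (prim_expr_order homega) subrr].
Qed.

(** For nonzero [epsilon] this says that the value of the cocycle at s is (epsilon : - s(epsilon) :
    0), a description that covers the three points of T at once. *)
Lemma flex_coord_gamma (s : Defs.Gal iota) : sg * sqrtD = d ->
  let w := flex_coord (iota d) (iota sg)
    (val (val (gamma_fun hsqrtc omega epsilon s))) in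
  w 0 2 = 0 /\ w 0 0 * s epsilon + w 0 1 * epsilon = 0.
Proof.
move=> dE; have sgc : iota sg * sqrtc = 3 * (2 * omega + 1) * iota d.
  by rewrite hsqrt -dE rmorphM; ring.
have h : s epsilon ^+ 3 = epsilon ^+ 3 by rewrite -rmorphXn /= heps gal_fix.
have w2 : omega ^+ 2 = - omega - 1 by rewrite -[LHS]subr0 -omega_rel; ring.
rewrite /gamma_fun; case: ifPn => [/eqP->|n1].
  rewrite [val (val _)](_ : _ = row3 0 1 0) // /flex_coord !row3E.
  by split; ring.
case: ifPn => [/eqP->|n2].
  rewrite [val (val _)](_ : _ = row3 0 sqrtc 1); last exact: affpt_val.
  rewrite /flex_coord !row3E; split; first by ring.
  by ring: sgc w2.
have -> : s epsilon = omega ^+ 2 * epsilon.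
  have : (s epsilon - epsilon) * (s epsilon - omega * epsilon)
      * (s epsilon - omega ^+ 2 * epsilon) == 0.
    apply/eqP; transitivity (s epsilon ^+ 3 - omega ^+ 3 * epsilon ^+ 3
       - (omega ^+ 2 + omega + 1)
         * (s epsilon ^+ 2 * epsilon - omega * s epsilon * epsilon ^+ 2)).
      by ring.
    by rewrite h omega_rel (prim_expr_order homega); ring.
  by rewrite !mulf_eq0 !subr_eq0 (negPf n1) (negPf n2) => /eqP.
rewrite [val (val _)](_ : _ = row3 0 (- sqrtc) 1); last first.
  by rewrite /= /neg_pt (negPf (affpt_neq0 _ _)) !affptE affpt_val.
rewrite /flex_coord !row3E; split; first by ring.
by ring: sgc w2.
Qed.

End GammaCoordinates.

Lemma flex_coordN (R : comNzRingType) (d s : R) v :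
  flex_coord d (- s) v = swap12 (flex_coord d s v).
Proof. by apply: row3P; rewrite /flex_coord /swap12 !row3E; split; ring. Qed.

(** * Base points on C for the three values of t *)

Section Gamma.
Variables (k : fieldType).
Variables (h2 : 2%N \notin [pchar k]) (h3 : 3%N \notin [pchar k]).
Variables (ks : fieldType) (iota : {rmorphism k -> ks}).
Variables (a b : k) (ha : a != 0) (hb : b != 0).
Variables (omega : ks) (homega : 3.-primitive_root omega) (sqrtD : k).
Variable hsqrtD : sqrtD ^+ 2 = - jac_coef a b / 27.
Variables (sqrtc : ks) (hsqrtc : sqrtc ^+ 2 = iota (jac_coef a b)).
Variable hsqrt : sqrtc = 3 * (2 * omega + 1) * iota sqrtD.
Variables (t : k) (epsilon : ks) (heps : epsilon ^+ 3 = iota t).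

(** It is enough to give homogeneous coordinates v of a base point such that s(v) is v translated by
    the cocycle, in the form of the relations. *)
Lemma phs_curve_of_gamma sg v : sg ^+ 2 = 1 -> v != 0 ->
  diag_cubic (iota a) (iota b) (- 1) v = 0 ->
  (forall s, tri (iota a) (iota b) (- 1) v
     (flex_coord (iota (a * b / 2)) (iota sg)
        (val (val (gamma_fun hsqrtc omega epsilon s)))) (map_mx s v)) ->
  phs_curve_of
    (Psi hsqrtc (h1_class (gamma hsqrtc h2 (jac_coef_neq0 h2 h3 ha hb) homega
       hsqrt heps)))
    (cubicC a b).
Proof.
move=> hsg nv fv hT; have [c nc cE] := val_proj nv.
have hp : on_curve iota (cubicC a b) (proj v).
  rewrite on_cubicC cE /diag_cubic !mxE; apply/eqP.
  by rewrite -[RHS](mulr0 (c ^+ 3)) -fv /diag_cubic; ring.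
apply: (phs_curve_of_Psi h2 h3 ha hb hsg hp) => s.
apply: (translation_eq h2 h3 ha hb hsg) => //; first exact: valP.
rewrite /= cE map_mxZ -[flex_coord _ _ _]scale1r.
exact: triZ (hT s).
Qed.

Let k2 : 2 != 0 :> k. Proof. by move: h2; rewrite inE. Qed.
(** Both [sqrtD] and ab/2 are square roots of -c/27, so their quotient is a sign. *)
Let sign_ex : exists2 sg : k, sg ^+ 2 = 1 & sg * sqrtD = a * b / 2.
Proof.
have sqE : sqrtD ^+ 2 = (a * b / 2) ^+ 2.
  rewrite hsqrtD /jac_coef; field; rewrite k2.
  rewrite (_ : 27 = 3 ^+ 3); last by ring.
  by rewrite (_ : 4 = 2 ^+ 2) ?expf_neq0 //; ring.
have nd : sqrtD != 0.
  by rewrite -sqrf_eq0 sqE expf_neq0 // !mulf_neq0 ?invr_eq0.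
exists (a * b / 2 / sqrtD); last by rewrite divfK.
by rewrite expr_div_n -sqE divff // expf_neq0.
Qed.

Lemma phs_curve_of_gamma_mem : t \in [:: - b / a; a; b] ->
  phs_curve_of
    (Psi hsqrtc (h1_class (gamma hsqrtc h2 (jac_coef_neq0 h2 h3 ha hb) homega
       hsqrt heps)))
    (cubicC a b).
Proof.
have [sg hsg hd] := sign_ex.
have hw s := flex_coord_gamma hsqrtc homega hsqrt heps s hd.
have hsN : (- sg) ^+ 2 = 1 by rewrite sqrrN.
rewrite !inE => /or3P[]/eqP tE.
(* For t = -b/a the point (epsilon : 1 : 0) lies on C, since a t + b = 0. *)
- apply: (@phs_curve_of_gamma (- sg) (row3 epsilon 1 0)) => //.
  + by apply/eqP => /rowP/(_ 1); rewrite row3E mxE; apply/eqP/oner_neq0.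
  + rewrite /diag_cubic !row3E heps tE rmorphM rmorphN fmorphV.
    by field; rewrite fmorph_eq0.
  + move=> s; have [w2 w01] := hw s.
    rewrite rmorphN flex_coordN; move: w2 w01.
    move: (flex_coord _ _ _) => w w2 w01; rewrite /tri /swap12.
    rewrite !(row3E, mxE) /= w2 rmorph1 rmorph0.
    (* As W = 0, two relations are trivial and the third is the one of [flex_coord_gamma]. *)
    by split; [ring | ring | rewrite -[RHS]w01; ring].
- apply: (@phs_curve_of_gamma (- sg) (row3 1 0 epsilon)) => //.
  + by apply/eqP => /rowP/(_ 0); rewrite row3E mxE; apply/eqP/oner_neq0.
  + by rewrite /diag_cubic !row3E heps tE; ring.
  + move=> s; have [w2 w01] := hw s.
    rewrite rmorphN flex_coordN; move: w2 w01.
    move: (flex_coord _ _ _) => w w2 w01; rewrite /tri /swap12.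
    rewrite !(row3E, mxE) /= w2 rmorph1 rmorph0.
    by split; [ring | rewrite -[RHS]w01; ring | ring].
(* Here s(epsilon) multiplies the first coordinate of the translation in the surviving relation, and
   the second one in the other two cases; hence [sg] in place of [- sg]. *)
- apply: (@phs_curve_of_gamma sg (row3 0 1 epsilon)) => //.
  + by apply/eqP => /rowP/(_ 1); rewrite row3E mxE; apply/eqP/oner_neq0.
  + by rewrite /diag_cubic !row3E heps tE; ring.
  + move=> s; have [w2 w01] := hw s; move: w2 w01.
    move: (flex_coord _ _ _) => w w2 w01; rewrite /tri /swap12.
    rewrite !(row3E, mxE) /= w2 rmorph1 rmorph0.
    by split; [rewrite -[RHS]w01; ring | ring | ring].
Qed.

End Gamma.

Theorem corollary2p2
  (k : fieldType) (h2 : 2%N \notin [pchar k]) (h3 : 3%N \notin [pchar k])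
  (ks : fieldType) (iota : {rmorphism k -> ks}) (hks : separable_closure iota)
  (a b : k) (ha : a != 0) (hb : b != 0)
  (omega : ks) (homega : 3.-primitive_root omega)
  (sqrtD : k) (hsqrtD : sqrtD ^+ 2 = - jac_coef a b / 27)
  (sqrtc : ks) (hsqrtc : sqrtc ^+ 2 = iota (jac_coef a b))
  (hsqrt : sqrtc = 3 * (2 * omega + 1) * iota sqrtD) :
  [/\ exists mu, is_phs (jac_coef a b) (cubicC a b) mu,
      exists xi : H1 (T3 hsqrtc), phs_curve_of (Psi hsqrtc xi) (cubicC a b)
    & forall t : k, t \in [:: - b / a; a; b] ->
      forall (epsilon : ks) (heps : epsilon ^+ 3 = iota t),
        phs_curve_of
          (Psi hsqrtc
            (h1_class (gamma hsqrtc h2 (jac_coef_neq0 h2 h3 ha hb) homega hsqrt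
                         heps)))
          (cubicC a b)].
Proof.
have main t (ht : t \in [:: - b / a; a; b]) epsilon heps :=
  @phs_curve_of_gamma_mem k h2 h3 ks iota a b ha hb omega homega sqrtD hsqrtD
    sqrtc hsqrtc hsqrt t epsilon heps ht.
split=> //.
  by exists (translation a b 1); apply: translation_is_phs; rewrite ?expr1n.
(* The class with t = a serves as witness that C lies in the image of [Psi]. *)
have [epsilon heps] := cube_root_ex h3 hks ha.
by eexists; apply: (main a _ epsilon heps); rewrite !inE eqxx orbT.
Qed.
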